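(* Let $d\ge 3$ and let $K\subset\mathbb{R}^d$ be a non-empty compact set. If \[ \lim_{s\downarrow 0}\int_{(s,\infty)} \big(P(\tilde{K}_t)\big)^{-1}\,dt=+\infty, \] then $\operatorname{cap}(K)=0$.
   Context: For a compact $K\subset\mathbb{R}^d$, $d\ge3$, the Newtonian capacity is $\operatorname{cap}(K)=\inf\{\int_{\mathbb{R}^d}|Du|^2:\ u\ge \mathbf 1_K,\ u\in D^1(\mathbb{R}^d)\cap C^0(\mathbb{R}^d)\}$, where $D^1(\mathbb{R}^d)$ is the set of $f\in L^1_{\rm loc}(\mathbb{R}^d)$ with $Df\in L^2(\mathbb{R}^d)$ that vanish at infinity, i.e. $|\{|f|>\varepsilon\}|<\infty$ for all $\varepsilon>0$. For a non-empty compact set $A$ and $r>0$, $A_r=\{x\in\mathbb{R}^d: \min_{y\in A}|x-y|\le r\}$. $U_K$ is the unbounded connected component of $\mathbb{R}^d\setminus K$ and $\tilde K=\mathbb{R}^d\setminus U_K$. $P(\cdot)$ denotes perimeter; for all but countably many $t>0$, $P(\tilde K_t)=\mathcal H^{d-1}(\partial \tilde K_t)$. *)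

(* Defs.v *)
From HB Require Import structures.
From mathcomp Require Import all_boot all_order all_algebra.
From mathcomp Require Import all_classical all_reals all_analysis.
Set Implicit Arguments. Unset Strict Implicit. Unset Printing Implicit Defensive.
Import Order.TTheory GRing.Theory Num.Theory.
Import numFieldNormedType.Exports.
Local Open Scope classical_set_scope.
Local Open Scope ring_scope.

Section Newton.
Variable R : realType.

Definition enorm d (x : 'rV[R]_d) : R := Num.sqrt (\sum_i x ord0 i ^+ 2).

Definition nbhd_closed d (A : set 'rV[R]_d) (r : R) : set 'rV[R]_d :=
  [set x | exists2 y, A y & enorm (x - y) <= r].

Definition unbdd_comp d (K : set 'rV[R]_d) : set 'rV[R]_d :=
  [set x | (~` K) x /\ ~ bounded_set (connected_component (~` K) x)].
Definition fill d (K : set 'rV[R]_d) : set 'rV[R]_d := ~` unbdd_comp K.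

Definition pd d (i : 'I_d) (f : 'rV[R]_d -> R) : 'rV[R]_d -> R :=
  fun x => derive f x (delta_mx 0 i).
Fixpoint Dl d (l : seq 'I_d) (f : 'rV[R]_d -> R) : 'rV[R]_d -> R :=
  match l with [::] => f | i :: l' => pd i (Dl l' f) end.

Definition smooth d (f : 'rV[R]_d -> R) : Prop :=
  forall l : seq 'I_d, continuous (Dl l f) /\
    forall (i : 'I_d) (x : 'rV[R]_d), derivable (Dl l f) x (delta_mx 0 i).
Definition C1 d (f : 'rV[R]_d -> R) : Prop :=
  continuous f /\ (forall (i : 'I_d) x, derivable f x (delta_mx 0 i)) /\
  forall i, continuous (pd i f).
Definition cpt_supp d (f : 'rV[R]_d -> R) : Prop :=
  compact (closure [set x | f x != 0]).

(* Lebesgue integral on R^d, as the iterated one-dimensional Lebesgue integral *)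
Fixpoint iint (n : nat) (f : seq R -> \bar R) : \bar R :=
  match n with
  | 0 => f [::]
  | n.+1 => (\int[@lebesgue_measure R]_x iint n (fun s => f (x :: s)))%E
  end.
Definition intRd d (F : 'rV[R]_d -> \bar R) : \bar R :=
  iint d (fun s => F (\row_i nth 0 s i)).
Definition volRd d (A : set 'rV[R]_d) : \bar R := intRd (fun x => (\1_A x)%:E).

Definition borel_fun d (f : 'rV[R]_d -> R) : Prop :=
  forall B : set R, open B ->
    <<s [set U : set 'rV[R]_d | open U] >> (f @^-1` B).
Definition loc_int d (f : 'rV[R]_d -> R) : Prop :=
  borel_fun f /\ forall C, compact C ->
    (intRd (fun x => (\1_C x * `|f x|)%:E) < +oo)%E.

Definition weak_grad d (u : 'rV[R]_d -> R) (g : 'I_d -> 'rV[R]_d -> R) : Prop :=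
  forall i, loc_int (g i) /\
    forall phi, smooth phi -> cpt_supp phi ->
      intRd (fun x => (u x * pd i phi x)%:E) =
      (- intRd (fun x => (g i x * phi x)%:E))%E.

Definition in_D1 d (u : 'rV[R]_d -> R) (g : 'I_d -> 'rV[R]_d -> R) : Prop :=
  [/\ loc_int u, weak_grad u g,
      (intRd (fun x => (\sum_i g i x ^+ 2)%:E) < +oo)%E &
      forall eps : R, 0 < eps -> (volRd [set x | (eps < `|u x|)%R] < +oo)%E].

Definition Ncap d (K : set 'rV[R]_d) : \bar R :=
  ereal_inf [set E | exists u g, [/\ in_D1 u g, continuous u,
      (forall x, \1_K x <= u x) &
      E = intRd (fun x => (\sum_i g i x ^+ 2)%:E)]].

Definition perimeter d (E : set 'rV[R]_d) : \bar R :=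
  ereal_sup [set v | exists phi : 'I_d -> 'rV[R]_d -> R,
    [/\ forall j, C1 (phi j),
        compact (closure [set x | exists j, phi j x != 0]),
        (forall x, enorm (\row_j phi j x) <= 1) &
        v = intRd (fun x => (\1_E x * \sum_j pd j (phi j) x)%:E)]].

Definition einv (x : \bar R) : \bar R :=
  match x with
  | EFin r => if r == 0 then +oo%E else (r^-1)%:E
  | _ => 0%E
  end.

End Newton.

(* Main.v *)
(* Let A = fill K and let P t be the perimeter of the closed t-neighbourhood of A.
   Take k >= 0 close in L1 to a bounded minorant of 1/P supported in [s, T], and
   test the capacity with u x = int_(dist x A)^oo k.  Formally |Du| = k(dist), so
   the coarea formula gives energy int k^2 P <= int k, while u = int k on A;
   rescaling u bounds the capacity by a multiple of 1 / int k, which is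
   arbitrarily small by hypothesis.
   The coarea formula and the singularities of the distance are avoided as
   follows.  The squared distance is replaced by a log-sum-exp soft minimum q of
   the squared distances to the points of a finite net of A.  As q - |x|^2 is
   concave, the field X = D sqrt q, slightly regularised and cut off, satisfies
   |X| <= 1 and div X <= d / s, hence has divergence bounded in L1 independently
   of the net.  Its flux int_(A_t) div X through A_t is at most P t by definition
   of the perimeter, and Fubini turns the integral of k^2 against this flux into
   the energy, up to an error that vanishes as the net is refined. *)
Require Import Defs.
From HB Require Import structures.
From mathcomp Require Import all_boot all_order all_algebra.
From mathcomp Require Import all_classical all_reals all_analysis.
From mathcomp Require Import measurable_realfun ring lra.
Import Order.TTheory GRing.Theory Num.Theory.
Import numFieldNormedType.Exports.
Local Open Scope classical_set_scope.
Local Open Scope ring_scope.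
Set Implicit Arguments.
Unset Strict Implicit.
Unset Printing Implicit Defensive.

(** Two obstacles shape the details. Away from a set the Laplacian of its distance is bounded above,
    but on the cut locus it may be a negative singular measure, near which the smoothed Laplacians
    concentrate as the net is refined. No pointwise lower bound can survive this; the two-sided
    control that is uniform in the net is in L1. Secondly, no measurability of [t -> P t] is
    established. The integral in the hypothesis is therefore used only through simple functions
    below 1/P, and under every later integral sign P is replaced by the flux, which is measurable by
    Fubini and is compared with P pointwise and from one side only. The order of choices matters:
    first the minorant f of 1/P, with its bound N and its support; next the bound C on the fluxes,
    which depends on that support; only then a precision e, small against N and C, that serves both
    for the approximation k of f and for the net. Continuity of k and strict positivity of q make u
    a C1 function, whose weak gradient is the classical one. *)

(** * Iterated integrals of functions of finite sequences, and Fubini's theorem for them *)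

Section IteratedIntegral.
Variable R : realType.
Local Notation mu := (@lebesgue_measure R).

Lemma eq_iint n (f g : seq R -> \bar R) :
  (forall s, size s = n -> f s = g s) -> iint n f = iint n g.
Proof.
elim: n f g => [|n IH] f g fg /=; first exact: fg.
by apply: eq_integral => x _; apply: IH => s sn; apply: fg; rewrite /= sn.
Qed.

(** In [iint] the last variable is innermost. Integrating it out leaves a function of one variable
    fewer, which is the induction step of most results below. *)
Lemma iint_rcons n (f : seq R -> \bar R) :
  iint n.+1 f = iint n (fun s => \int[mu]_x f (rcons s x))%E.
Proof.
elim: n f => [//|n IH] f.
transitivity (\int[mu]_x iint n.+1 (fun s => f (x :: s)))%E => //.
by under eq_integral => x _ do rewrite IH.
Qed.

(* Measurability of a function of n variables is tested by substituting
   measurable functions on an arbitrary measurable space, so that no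
   sigma-algebra on sequences is needed. *)
Definition mseq n (f : seq R -> R) :=
  forall dd (T : measurableType dd) (p : seq (T -> R)), size p = n ->
  (forall i, measurable_fun setT (nth (cst 0) p i)) ->
  measurable_fun setT (fun t => f [seq q t | q <- p]).

Definition box (B : R) (s : seq R) := all (fun x => `|x| <= B) s.

(* [bbs]: Bounded with Box Support.  On this class all the iterated integrals
   below are finite and may be exchanged. *)
Definition bbs n (f : seq R -> R) :=
  mseq n f /\ exists M B : R, [/\ 0 <= M, 0 <= B,
    forall s, size s = n -> `|f s| <= M &
    forall s, size s = n -> ~~ box B s -> f s = 0].

Definition int_last (f : seq R -> R) (s : seq R) : R :=
  (\int[mu]_x f (rcons s x))%R.

Lemma bounded_itv_integrable (g : R -> R) (M B : R) :
  measurable_fun setT g -> (forall x, `|g x| <= M) ->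
  (forall x, B < `|x| -> g x = 0) -> mu.-integrable setT (EFin \o g).
Proof.
move=> mg gM gB.
have -> : g = g \_ `[(- B), B].
  apply/funext => x; rewrite patchE; case: ifPn => // xB.
  apply: gB; rewrite ltNge; apply: contra xB => xB.
  by rewrite inE /= in_itv /= -ler_norml.
rewrite -[EFin \o _]/(EFin \o restrict _ _) -restrict_EFin.
apply/integrable_restrict => //; rewrite setTI.
apply: measurable_bounded_integrable => //.
- by rewrite /= lebesgue_measure_itv /=; case: ifP => _; rewrite ?ltry // -EFinD ltry.
- exact: measurable_funTS.
- exists M; split; first exact: num_real.
  by move=> N MN x _; exact: le_trans (gM x) (ltW MN).
Qed.

Lemma Rintegral_itv_le (g : R -> R) (M B : R) : 0 <= M -> 0 <= B ->
  measurable_fun setT g -> (forall x, `|g x| <= M) ->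
  (forall x, B < `|x| -> g x = 0) -> `|\int[mu]_x g x| <= M * (2 * B).
Proof.
move=> M0 B0 mg gM gB.
have ig := bounded_itv_integrable mg gM gB.
have -> : g = g \_ `[(- B), B].
  apply/funext => x; rewrite patchE; case: ifPn => // xB.
  apply: gB; rewrite ltNge; apply: contra xB => xB.
  by rewrite inE /= in_itv /= -ler_norml.
rewrite -Rintegral_mkcond.
have igB : mu.-integrable `[(- B), B] (EFin \o g).
  exact: integrableS ig.
apply: le_trans (le_normr_Rintegral _ _) _ => //.
have icM : mu.-integrable `[(- B), B] (EFin \o cst M).
  apply: measurable_bounded_integrable => //.
  - by rewrite /= lebesgue_measure_itv /=; case: ifP => _; rewrite ?ltry // -EFinD ltry.
  - exists M; split; first exact: num_real.
    by move=> N MN x _ /=; rewrite ger0_norm // ltW.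
apply: (le_trans (@le_Rintegral _ _ _ mu `[(- B), B]%classic (fun x => `|g x|) (cst M) _ _ _ _)); last 1 first.
- rewrite Rintegral_cst // /=.
  rewrite lebesgue_measure_itv /= lte_fin; case: ifPn => [_|_] /=.
    by rewrite ler_wpM2l //; lra.
  by rewrite mulr0 mulr_ge0 // mulr_ge0.
- by [].
- exact: integrable_norm.
- by [].
- by move=> x _; exact: gM.
Qed.

Lemma mseq_rcons n f dd (T : measurableType dd) (p : seq (T -> R)) :
  mseq n.+1 f -> size p = n -> (forall i, measurable_fun setT (nth (cst 0) p i)) ->
  measurable_fun setT (fun z : T * R => f (rcons [seq q z.1 | q <- p] z.2)).
Proof.
move=> mf pn mp.
have -> : (fun z : T * R => f (rcons [seq q z.1 | q <- p] z.2)) =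
    (fun z => f [seq q z | q <- rcons [seq q \o fst | q <- p] snd]).
  by apply/funext => z; rewrite map_rcons -map_comp.
apply: mf; first by rewrite size_rcons size_map pn.
move=> i; rewrite nth_rcons size_map.
case: ltnP => ip.
  rewrite (nth_map (cst 0)) //.
  by apply: measurableT_comp => //; exact: mp.
by case: ifP => _; [exact: measurable_snd|exact: measurable_cst].
Qed.

Lemma mseq_rcons1 n f (s : seq R) :
  mseq n.+1 f -> size s = n -> measurable_fun setT (fun x : R => f (rcons s x)).
Proof.
move=> mf sn.
have -> : (fun x : R => f (rcons s x)) =
    (fun x => f [seq q x | q <- rcons [seq cst y | y <- s] id]).
  by apply/funext => z; rewrite map_rcons -map_comp map_id.
apply: mf; first by rewrite size_rcons size_map sn.
move=> i; rewrite nth_rcons size_map.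
case: ltnP => ip; first by rewrite (nth_map 0).
by case: ifP => _.
Qed.

Lemma bbs_rcons1 n f (s : seq R) : bbs n.+1 f -> size s = n ->
  mu.-integrable setT (EFin \o (fun x => f (rcons s x))).
Proof.
move=> [mf [M [B [M0 B0 fM fB]]]] sn.
apply: (@bounded_itv_integrable _ M B).
- exact: mseq_rcons1 mf sn.
- by move=> x; apply: fM; rewrite size_rcons sn.
- move=> x Bx; apply: fB; rewrite ?size_rcons ?sn //.
  by rewrite /box all_rcons /= leNgt Bx.
Qed.

Lemma bbs_int_last n f : bbs n.+1 f -> bbs n (int_last f).
Proof.
move=> bf; have [mf [M [B [M0 B0 fM fB]]]] := bf; split; last first.
  exists (M * (2 * B)), B; split => //.
  - by rewrite mulr_ge0 // mulr_ge0.
  - move=> s sn; apply: Rintegral_itv_le => //.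
    + exact: mseq_rcons1 mf sn.
    + by move=> x; apply: fM; rewrite size_rcons sn.
    + move=> x Bx; apply: fB; rewrite ?size_rcons ?sn //.
      by rewrite /box all_rcons /= leNgt Bx.
  - move=> s sn sB; rewrite /int_last.
    under eq_Rintegral => x _.
      rewrite fB; last 2 first.
      - by rewrite size_rcons sn.
      - by rewrite /box all_rcons negb_and sB orbT.
      over.
    by rewrite Rintegral_cst // mul0r.
move=> dd T p pn mp; rewrite /int_last /Rintegral.
suff: measurable_fun setT ((fun t : T => (\int[mu]_x (f (rcons [seq q t | q <- p] x))%:E)%E) : T -> \bar R).
  by move=> m; exact: (measurableT_comp (fine_measurable measurableT) m).
have m1 := mseq_rcons mf pn mp.
have m2 : measurable_fun setT (fun z : T * R => (f (rcons [seq q z.1 | q <- p] z.2))%:E).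
  exact/measurable_EFinP.
(* Tonelli gives measurability in the parameter for nonnegative integrands, hence the split into
   positive and negative parts. *)
under eq_fun do rewrite integralE.
apply: emeasurable_funB.
- have := @measurable_fun_fubini_tonelli_F _ _ T (measurableTypeR R) R (@lebesgue_measure R) _ (measurable_funepos m2) (funepos_ge0 _).
  by congr measurable_fun; apply/funext => t; apply: eq_integral => x _; rewrite !funeposE.
- have := @measurable_fun_fubini_tonelli_F _ _ T (measurableTypeR R) R (@lebesgue_measure R) _ (measurable_funeneg m2) (funeneg_ge0 _).
  by congr measurable_fun; apply/funext => t; apply: eq_integral => x _; rewrite !funenegE.
Qed.

Lemma iint_int_last n f : bbs n.+1 f ->
  iint n.+1 (EFin \o f) = iint n (EFin \o int_last f).
Proof.
move=> bf; rewrite iint_rcons; apply: eq_iint => s sn /=.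
rewrite /int_last /Rintegral fineK //.
by apply: integrable_fin_num => //; exact: bbs_rcons1 bf sn.
Qed.

(** On [bbs] nothing is lost by [fine]; see [iintJ]. *)
Definition J n (f : seq R -> R) : R := fine (iint n (EFin \o f)).

Lemma JS n f : bbs n.+1 f -> J n.+1 f = J n (int_last f).
Proof. by move=> bf; rewrite /J iint_int_last. Qed.

Lemma iintJ n f : bbs n f -> iint n (EFin \o f) = (J n f)%:E.
Proof.
elim: n f => [//|n IH] f bf; rewrite JS // -IH ?iint_int_last //.
exact: bbs_int_last.
Qed.

Lemma eq_J n f g : (forall s, size s = n -> f s = g s) -> J n f = J n g.
Proof. by move=> fg; congr fine; apply: eq_iint => s sn /=; rewrite fg. Qed.

Lemma boxP (B : R) s : reflect (forall i, `|nth 0 s i| <= B \/ (size s <= i)%N) (box B s).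
Proof.
apply: (iffP allP) => [h i|h x /(nthP 0)[i ilt <-]].
  case: (ltnP i (size s)) => ilt; last by right.
  by left; apply: h; exact: mem_nth.
by case: (h i) => //; rewrite leqNgt ilt.
Qed.

Lemma box_le (B B' : R) s : B <= B' -> box B s -> box B' s.
Proof. by move=> BB; apply: sub_all => x /= /le_trans; apply. Qed.

Lemma mseqD n f g : mseq n f -> mseq n g -> mseq n (fun s => f s + g s).
Proof.
by move=> mf mg dd T p pn mp; apply: measurable_funD; [exact: mf|exact: mg].
Qed.

Lemma mseqM n f g : mseq n f -> mseq n g -> mseq n (fun s => f s * g s).
Proof.
by move=> mf mg dd T p pn mp; apply: measurable_funM; [exact: mf|exact: mg].
Qed.

Lemma mseq_cst n c : mseq n (fun=> c).
Proof. by move=> dd T p pn mp; exact: measurable_cst. Qed.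

Lemma mseq_comp n (h : R -> R) f : measurable_fun setT h -> mseq n f ->
  mseq n (fun s => h (f s)).
Proof.
by move=> mh mf dd T p pn mp; apply: (measurableT_comp mh); exact: mf.
Qed.

Lemma bbsD n f g : bbs n f -> bbs n g -> bbs n (fun s => f s + g s).
Proof.
move=> [mf [M [B [M0 B0 fM fB]]]] [mg [M' [B' [M'0 B'0 gM gB]]]].
split; first exact: mseqD.
exists (M + M'), (B + B'); split; rewrite ?addr_ge0 //.
  by move=> s sn; apply: le_trans (ler_normD _ _) _; rewrite lerD ?fM ?gM.
move=> s sn sB; rewrite fB ?gB ?addr0 //; apply: contra sB; apply: box_le; lra.
Qed.

Lemma bbsMl n f g M : mseq n g -> (forall s, size s = n -> `|g s| <= M) ->
  bbs n f -> bbs n (fun s => g s * f s).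
Proof.
move=> mg gM [mf [M' [B [M'0 B0 fM fB]]]]; split; first exact: mseqM.
exists (`|M| * M'), B; split; rewrite ?mulr_ge0 //.
  move=> s sn; rewrite normrM ler_pM ?fM //; apply: le_trans (gM _ sn) _.
  exact: ler_norm.
by move=> s sn sB; rewrite fB ?mulr0.
Qed.

Lemma bbsZ n c f : bbs n f -> bbs n (fun s => c * f s).
Proof. by apply: (@bbsMl _ _ _ `|c|) => //; exact: mseq_cst. Qed.

Lemma bbs_norm n f : bbs n f -> bbs n (fun s => `|f s|).
Proof.
move=> [mf [M [B [M0 B0 fM fB]]]]; split; first by apply: mseq_comp.
exists M, B; split => // [s sn|s sn sB]; first by rewrite normr_id fM.
by rewrite fB ?normr0.
Qed.

Lemma bbs_ext n f g : (forall s, size s = n -> f s = g s) -> bbs n f -> bbs n g.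
Proof.
move=> fg [mf [M [B [M0 B0 fM fB]]]]; split; last first.
  by exists M, B; split => // s sn; rewrite -fg //; [exact: fM|exact: fB].
move=> dd T p pn mp; have := mf _ _ p pn mp; congr measurable_fun.
by apply/funext => t; rewrite fg // size_map.
Qed.

Lemma int_lastD n f g s : bbs n.+1 f -> bbs n.+1 g -> size s = n ->
  int_last (fun s => f s + g s) s = int_last f s + int_last g s.
Proof.
move=> bf bg sn; rewrite /int_last RintegralD //.
- exact: bbs_rcons1 bf sn.
- exact: bbs_rcons1 bg sn.
Qed.

Lemma JD n f g : bbs n f -> bbs n g -> J n (fun s => f s + g s) = J n f + J n g.
Proof.
elim: n f g => [//|n IH] f g bf bg.
rewrite !JS //; last exact: bbsD.
rewrite -IH //; try exact: bbs_int_last.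
by apply: eq_J => s sn; rewrite (int_lastD bf bg).
Qed.

Lemma JZ n c f : bbs n f -> J n (fun s => c * f s) = c * J n f.
Proof.
elim: n f => [//|n IH] f bf.
rewrite !JS //; last exact: bbsZ.
rewrite -IH //; try exact: bbs_int_last.
apply: eq_J => s sn; rewrite /int_last RintegralZl //; exact: bbs_rcons1 bf sn.
Qed.

Lemma le_J n f g : bbs n f -> bbs n g -> (forall s, size s = n -> f s <= g s) ->
  J n f <= J n g.
Proof.
elim: n f g => [|n IH] f g bf bg fg; first exact: fg.
rewrite !JS //; apply: IH; try exact: bbs_int_last.
move=> s sn; rewrite /int_last; apply: le_Rintegral => //.
- exact: bbs_rcons1 bf sn.
- exact: bbs_rcons1 bg sn.
- by move=> x _; apply: fg; rewrite size_rcons sn.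
Qed.

Lemma J_bound n f M B : 0 <= M -> 0 <= B -> bbs n f ->
  (forall s, size s = n -> `|f s| <= M) ->
  (forall s, size s = n -> ~~ box B s -> f s = 0) ->
  `|J n f| <= M * (2 * B) ^+ n.
Proof.
elim: n f M => [|n IH] f M M0 B0 bf fM fB.
  by rewrite expr0 mulr1; exact: (fM [::]).
rewrite JS // exprS mulrA; apply: IH => //.
- by rewrite !mulr_ge0.
- exact: bbs_int_last.
- move=> s sn; apply: Rintegral_itv_le => //.
  + by case: bf => mf _; exact: mseq_rcons1 mf sn.
  + by move=> x; apply: fM; rewrite size_rcons sn.
  + move=> x Bx; apply: fB; rewrite ?size_rcons ?sn //.
    by rewrite /box all_rcons /= leNgt Bx.
- move=> s sn sB; rewrite /int_last.
  under eq_Rintegral => x _.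
    rewrite fB; last 2 first.
    - by rewrite size_rcons sn.
    - by rewrite /box all_rcons negb_and sB orbT.
    over.
  by rewrite Rintegral_cst // mul0r.
Qed.

Lemma ler_norm_J n f : bbs n f -> `|J n f| <= J n (fun s => `|f s|).
Proof.
move=> bf; rewrite ler_norml; apply/andP; split.
  rewrite -mulN1r -JZ; last exact: bbs_norm.
  apply: le_J => //; first exact/bbsZ/bbs_norm.
  by move=> s _; rewrite mulN1r lerNl -normrN ler_norm.
by apply: le_J => // [|s _]; [exact: bbs_norm|exact: ler_norm].
Qed.

Lemma Fubini_box (g : R * R -> R) (M B : R) :
  measurable_fun setT g -> (forall x y, `|g (x, y)| <= M) ->
  (forall x y, B < `|x| \/ B < `|y| -> g (x, y) = 0) ->
  \int[mu]_x (\int[mu]_y g (x, y)) = \int[mu]_y (\int[mu]_x g (x, y)).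
Proof.
move=> mg gM gB.
set T := (measurableTypeR R * measurableTypeR R)%type.
pose A : set T := `[(- B), B]%classic `*` `[(- B), B]%classic.
have mA : measurable A by apply: measurableX.
have fA : ((mu \x mu)%E A < +oo)%E.
  rewrite /A (@product_measure1E _ _ (measurableTypeR R) (measurableTypeR R)
    R mu mu `[(- B), B]%classic `[(- B), B]%classic) //.
  rewrite /= lebesgue_measure_itv /=.
  by case: ifP => _; rewrite ?mule0 ?ltry // -EFinD -EFinM ltry.
have ig : (mu \x mu)%E.-integrable setT (EFin \o g : T -> \bar R).
  have -> : g = (g : T -> R) \_ A.
    apply/funext => -[x y]; rewrite patchE; case: ifPn => // xB.
    apply: gB; apply: contrapT => /not_orP[/negP xB' /negP yB].
    move: xB; apply/negP; rewrite negbK inE /A /= !in_itv /= -!ler_norml.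
    by rewrite !leNgt.
  rewrite -[EFin \o _]/(EFin \o restrict _ _) -restrict_EFin.
  apply/integrable_restrict => //; rewrite setTI.
  apply: measurable_bounded_integrable => //.
  - exact: measurable_funTS.
  - exists M; split; first exact: num_real.
    by move=> N MN [x y] _; exact: le_trans (gM x y) (ltW MN).
have fin1 x : (\int[mu]_y (g (x, y))%:E)%E \is a fin_num.
  apply: integrable_fin_num => //; apply: (@bounded_itv_integrable _ M B) => //.
  - by apply: measurableT_comp => //; exact: measurable_pair1.
  - by move=> y yB; apply: gB; right.
have fin2 y : (\int[mu]_x (g (x, y))%:E)%E \is a fin_num.
  apply: integrable_fin_num => //; apply: (@bounded_itv_integrable (fun x => g (x, y)) M B) => //.
  - by apply: measurableT_comp => //; exact: measurable_pair2.
  - by move=> x xB; apply: gB; left.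
have := Fubini ig.
rewrite /Rintegral => E; congr fine.
under eq_integral => x _ do rewrite fineK //.
by rewrite [LHS]E; apply: eq_integral => y _; rewrite fineK.
Qed.

(** Rotation makes the first variable the last one, so that results on [int_last] carry over to
    integration in the first variable. *)
Lemma bbs_rotr n f : bbs n.+1 f -> bbs n.+1 (fun s => f (rotr 1 s)).
Proof.
move=> [mf [M [B [M0 B0 fM fB]]]]; split; last first.
  exists M, B; split => // s sn; first by apply: fM; rewrite size_rotr.
  move=> sB; apply: fB; rewrite ?size_rotr //.
  by apply: contra sB; rewrite /box !(eq_all_r (mem_rotr _ _)).
move=> dd T p pn mp.
have -> : (fun t => f (rotr 1 [seq q t | q <- p])) =
    (fun t => f [seq q t | q <- rotr 1 p]).
  by apply/funext => t; rewrite map_rotr.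
apply: mf; first by rewrite size_rotr.
case/lastP: p pn mp => [//|p q] pn mp.
rewrite rotr1_rcons => -[|i] /=.
  by have := mp (size p); rewrite nth_rcons ltnn eqxx.
have := mp i; rewrite nth_rcons.
case: ltnP => // ip _; rewrite nth_default //; exact: measurable_cst.
Qed.

Lemma bbs_int_cons n f : bbs n.+1 f -> bbs n (fun s => \int[mu]_x f (x :: s)).
Proof.
move=> /bbs_rotr/bbs_int_last; apply: bbs_ext => s sn; rewrite /int_last.
by apply: eq_Rintegral => x _; rewrite rotr1_rcons.
Qed.

Lemma bbs_cons n f x : bbs n.+1 f -> bbs n (fun s => f (x :: s)).
Proof.
move=> [mf [M [B [M0 B0 fM fB]]]]; split; last first.
  exists M, B; split => // s sn; first by apply: fM; rewrite /= sn.
  by move=> sB; apply: fB; rewrite /= ?sn // negb_and sB orbT.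
move=> dd T p pn mp; apply: (mf _ _ (cst x :: p)); first by rewrite /= pn.
by case=> [|i] /=; [exact: measurable_cst|exact: mp].
Qed.

Lemma J_cons n f : bbs n.+1 f -> J n.+1 f = \int[mu]_x J n (fun s => f (x :: s)).
Proof.
move=> bf; rewrite /J /Rintegral /=; congr fine; apply: eq_integral => x _.
by rewrite -[RHS](iintJ (bbs_cons x bf)).
Qed.

(** The last variable is integrated out before the induction hypothesis is applied; what remains is
    to exchange the first and the last variable, a case of [Fubini_box]. *)
Lemma J_Fubini n f : bbs n.+1 f -> J n.+1 f = J n (fun s => \int[mu]_x f (x :: s)).
Proof.
elim: n f => [|n IH] f bf; rewrite J_cons //.
transitivity (\int[mu]_x J n (fun s => int_last f (x :: s))).
  by apply: eq_Rintegral => x _; rewrite JS //; exact: bbs_cons.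
rewrite -J_cons ?(IH (int_last f)); try exact: bbs_int_last.
rewrite JS; last exact: bbs_int_cons.
apply: eq_J => s sn; rewrite /int_last.
have [mf [M [B [M0 B0 fM fB]]]] := bf.
have := @Fubini_box (fun z => f (z.1 :: rcons s z.2)) M B; apply.
- have := @mf _ (measurableTypeR R * measurableTypeR R)%type (fst :: rcons [seq cst y | y <- s] snd).
  rewrite /= size_rcons size_map sn => /(_ erefl).
  have -> : (fun t : measurableTypeR R * measurableTypeR R =>
      f (t.1 :: [seq q t | q <- rcons [seq cst y | y <- s] snd])) =
      (fun z => f (z.1 :: rcons s z.2)).
    by apply/funext => z; rewrite map_rcons -map_comp map_id.
  apply=> -[|i] /=; first exact: measurable_fst.
  rewrite nth_rcons size_map; case: ltnP => ip; first by rewrite (nth_map 0).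
  by case: ifP => _; [exact: measurable_snd|exact: measurable_cst].
- by move=> x y; apply: fM; rewrite /= size_rcons sn.
- move=> x y xy; apply: fB; first by rewrite /= size_rcons sn.
  by rewrite /box /= all_rcons !negb_and -!ltNge; case: xy => ->; rewrite ?orbT.
Qed.

Definition ins T i (y : T) (s : seq T) := take i s ++ y :: drop i s.

Lemma size_ins T i (y : T) s : size (ins i y s) = (size s).+1.
Proof. by rewrite /ins size_cat /= addnS -size_cat cat_take_drop. Qed.

Lemma nth_ins T i (y : T) s x0 j : (i <= size s)%N ->
  nth x0 (ins i y s) j =
  if (j < i)%N then nth x0 s j else if j == i then y else nth x0 s j.-1.
Proof.
move=> is_; rewrite /ins nth_cat size_takel //.
case: ltnP => ij; first by rewrite nth_take.
case: eqP => [->|/eqP ji]; first by rewrite subnn.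
have {ij ji} ij : (i < j)%N by rewrite ltn_neqAle eq_sym ji.
case: j ij => // j ij; rewrite subSn //= nth_drop subnKC //.
Qed.

Lemma map_ins T U (h : T -> U) i (y : T) s : map h (ins i y s) = ins i (h y) (map h s).
Proof. by rewrite /ins map_cat /= map_take map_drop. Qed.

Lemma box_ins B i y s : box B (ins i y s) = (`|y| <= B) && box B s.
Proof.
rewrite /box /ins all_cat /= -[in RHS](cat_take_drop i s) all_cat.
by rewrite andbCA.
Qed.

Lemma bbs_ins n f i : bbs n.+1 f -> (i <= n)%N ->
  bbs n.+1 (fun s => f (ins i (head 0 s) (behead s))).
Proof.
move=> [mf [M [B [M0 B0 fM fB]]]] i_n; split; last first.
  exists M, B; split => // -[//|x s] sn; first by apply: fM; rewrite size_ins.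
  by move=> sB; apply: fB; rewrite ?size_ins // box_ins.
move=> dd T [//|q p] [pn] mp.
have -> : (fun t => f (ins i (head 0 [seq q t | q <- q :: p]) (behead [seq q t | q <- q :: p]))) =
    (fun t => f [seq q t | q <- ins i q p]).
  by apply/funext => t; rewrite map_ins.
apply: mf; first by rewrite size_ins pn.
move=> j; rewrite nth_ins ?pn //; case: ifP => _; first exact: (mp j.+1).
by case: ifP => _; [exact: (mp 0%N)|exact: (mp j.-1.+1)].
Qed.

Lemma bbs_int_ins n f i : bbs n.+1 f -> (i <= n)%N ->
  bbs n (fun s => \int[mu]_y f (ins i y s)).
Proof. by move=> bf i_n; have /bbs_int_cons := bbs_ins bf i_n. Qed.

(** Any coordinate can be made the innermost one; a partial derivative can thus be integrated first
    along its own direction. *)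
Lemma J_ins n f i : bbs n.+1 f -> (i <= n)%N ->
  J n.+1 f = J n (fun s => \int[mu]_y f (ins i y s)).
Proof.
elim: i n f => [|i IH] n f bf i_n.
  by rewrite J_Fubini //; apply: eq_J => s _; rewrite /ins take0 drop0.
case: n bf i_n => // n bf i_n; rewrite J_cons // J_cons; last exact: bbs_int_ins.
by apply: eq_Rintegral => x _; rewrite IH //; exact: bbs_cons.
Qed.

End IteratedIntegral.

(** * Integrals over row vectors, directional derivatives, and vanishing integrals of derivatives *)

Section RowVectors.
Variable R : realType.
Local Notation mu := (@lebesgue_measure R).

Definition rowS n (s : seq R) : 'rV[R]_n := \row_i nth 0 s i.

Lemma ler_norm_coord n (x : 'rV[R]_n) i : `|x ord0 i| <= `|x|.
Proof.
have : `|x ord0 i| \in [seq `|x ij.1 ij.2| | ij : 'I_1 * 'I_n].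
  by apply/mapP; exists (ord0, i) => //=; rewrite mem_enum.
by move=> /mapP[j Hj ->]; rewrite [leRHS]/Num.norm /= mx_normrE; apply/bigmax_geP; right => /=; exists j.
Qed.

Lemma norm_rV_le n (x : 'rV[R]_n) c : 0 <= c -> (forall i, `|x ord0 i| <= c) -> `|x| <= c.
Proof.
move=> c0 xc; rewrite [leLHS]/Num.norm /= mx_normrE; apply/bigmax_leP; split => //.
by move=> [i j] _ /=; rewrite ord1.
Qed.

(** The norm on row vectors is the sup norm, so boxes are its closed balls. *)
Lemma box_norm n B (s : seq R) : 0 <= B -> size s = n ->
  box B s = (`|rowS n s| <= B).
Proof.
move=> B0 sn; apply/idP/idP => [/boxP sB|sB].
  apply: norm_rV_le => // i; rewrite mxE; case: (sB i) => //.
  by rewrite sn leqNgt ltn_ord.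
apply/boxP => i; case: (ltnP i (size s)) => ilt; last by right.
left; apply: le_trans sB; rewrite sn in ilt.
by have := ler_norm_coord (rowS n s) (Ordinal ilt); rewrite mxE.
Qed.

(** An open set is the countable union of those cubes [Q a] inside it whose centre lies on the grid
    of mesh 1/(m+1) and whose radius is 1/(m+1); membership in a cube is tested coordinate by
    coordinate. *)
Lemma open_measurable_rV n dd (T : measurableType dd) (P : T -> 'rV[R]_n)
    (U : set 'rV[R]_n) : (forall i, measurable_fun setT (fun t => P t ord0 i)) ->
  open U -> measurable (P @^-1` U).
Proof.
move=> mP oU.
pose Q (a : {ffun 'I_n -> int} * nat) : set 'rV[R]_n :=
  [set x | forall i, `|x ord0 i - (a.1 i)%:~R / a.2.+1%:R| < a.2.+1%:R^-1].
pose D := [set a | Q a `<=` U].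
have -> : P @^-1` U = \bigcup_a (if `[< D a >] then P @^-1` Q a else set0).
  apply/seteqP; split => [t /= Ut|t [a _]]; last first.
    by case: asboolP => // Da /= /Da.
  have [e /= e0 eU] : nbhs_ball (P t) U by apply/nbhs_ballP; exact: oU.
  (* Two points of one cube are at distance at most 2/(m+1), which has to be less than [e]. *)
  pose m := Num.truncn (2 / e).
  have m0 : 0 < m.+1%:R :> R by [].
  have me : 2 / m.+1%:R < e.
    rewrite ltr_pdivrMr // mulrC -ltr_pdivrMr //; exact: truncnS_gt.
  pose a := ([ffun i => Num.floor (P t ord0 i * m.+1%:R)], m).
  have Qa : Q a (P t).
    move=> i /=; rewrite ffunE.
    have -> : P t ord0 i - (Num.floor (P t ord0 i * m.+1%:R))%:~R / m.+1%:R =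
      (P t ord0 i * m.+1%:R - (Num.floor (P t ord0 i * m.+1%:R))%:~R) / m.+1%:R.
      by rewrite mulrBl mulfK // gt_eqF.
    rewrite normrM [X in _ * X]gtr0_norm ?invr_gt0 // -[ltRHS]mul1r ltr_pM2r ?invr_gt0 //.
    have := floor_le (P t ord0 i * m.+1%:R).
    have := floorD1_gt (P t ord0 i * m.+1%:R).
    rewrite intrD; set z := _%:~R; move=> h1 h2.
    by rewrite ger0_norm; lra.
  exists a => //; case: asboolP => // -[].
  move=> x Qx; apply: eU; rewrite mx_norm_ball /ball_ /=.
  apply: le_lt_trans me; apply: norm_rV_le; first by rewrite divr_ge0.
  move=> i; rewrite !mxE; have := Qa i; have := Qx i; rewrite /= !ffunE.
  set c := (_)%:~R / _ => h1 h2.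
  have -> : P t ord0 i - x ord0 i = (P t ord0 i - c) - (x ord0 i - c) by ring.
  apply: le_trans (ler_normB _ _) _.
  have -> : 2 / m.+1%:R = m.+1%:R^-1 + m.+1%:R^-1 :> R by rewrite mulrDl mul1r.
  by apply: lerD; apply: ltW.
apply: countable_bigcupT_measurable; first exact: countableP.
move=> a; case: asboolP => // _.
have -> : P @^-1` Q a = \bigcap_(i in [set: 'I_n])
   ((fun t => `|P t ord0 i - (a.1 i)%:~R / a.2.+1%:R|) @^-1` `]-oo, a.2.+1%:R^-1[).
  apply/seteqP; split => t /= h i; first by move=> _; rewrite /= in_itv /= h.
  by have := h i I; rewrite /= in_itv.
apply: fin_bigcap_measurable => // i _.
rewrite -[X in measurable X]setTI.
have mf : measurable_fun setT (fun t => `|P t ord0 i - (a.1 i)%:~R / a.2.+1%:R|).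
  by apply: measurableT_comp => //; apply: measurable_funB.
by apply: mf => //; exact: measurable_itv.
Qed.

Lemma mseq_row n (F : 'rV[R]_n -> R) : continuous F ->
  mseq n (fun s => F (rowS n s)).
Proof.
move=> cF dd T p pn mp.
apply: (measurability _ (RGenOpens.measurableE R)).
move=> _ [_ [a [b ->]] <-].
have oA : open (`]a, b[%classic : set R) by exact: interval_open.
rewrite setTI; set A := `]a, b[%classic in oA *.
apply: (@open_measurable_rV n _ T (fun t => rowS n [seq q t | q <- p]) (F @^-1` A)).
  move=> i; have := mp i; congr measurable_fun; apply/funext => t.
  by rewrite mxE (nth_map (cst 0)) // pn.
by apply: open_comp => // x _; exact: cF.
Qed.

Lemma bbs0 n : bbs n (fun=> 0 : R).
Proof.
split; first exact: mseq_cst.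
by exists 0, 0; split => // s _; rewrite normr0.
Qed.

Lemma J0 n : J n (fun=> 0 : R) = 0.
Proof.
apply/normr0_eq0/le_anti; rewrite normr_ge0 andbT.
rewrite -[leRHS](mul0r ((2 * 0) ^+ n)).
by apply: J_bound => //; [exact: bbs0|move=> s _; rewrite normr0].
Qed.

(* [pd i] is a directional derivative along a basis vector; composing with the
   line through [x] turns it into a one-variable derivative at [0]. *)
Lemma derive_line (V : normedModType R) (f : V -> R) (x v : V) :
  derive f x v = derive (fun h : R => f (h *: v + x)) 0 1.
Proof.
rewrite /derive; set g1 := fun h => h^-1 *: _; set g2 := fun h => h^-1 *: _.
suff -> : g1 = g2 by [].
by rewrite funeqE /g1 /g2 => h /=; rewrite addr0 scale0r add0r [_%:A]mulr1.
Qed.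

Lemma is_derive_lineP (V : normedModType R) (f : V -> R) (x v : V) (df : R) :
  is_derive x v f df <-> is_derive (0 : R) 1 (fun h : R => f (h *: v + x)) df.
Proof.
have E := derive_line f x v.
split=> -[D1 D2]; split.
- exact: ((derivable1P f x v).1 D1).
- exact: etrans (esym E) D2.
- exact: ((derivable1P f x v).2 D1).
- exact: etrans E D2.
Qed.

Lemma is_derive_comp (V : normedModType R) (f : V -> R) (h : R -> R) (x v : V)
    (df dh : R) :
  is_derive x v f df -> is_derive (f x) 1 h dh ->
  is_derive x v (h \o f) (dh * df).
Proof.
move=> /is_derive_lineP Df Dh; apply/is_derive_lineP.
have Dh' : is_derive (f (0 *: v + x)) 1 h dh by rewrite scale0r add0r.
have := @is_derive1_comp _ h (fun h : R => f (h *: v + x)) 0 dh df Dh' Df.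
by move=> /is_derive_eq; apply.
Qed.

Definition vanish n (B : R) (f : 'rV[R]_n -> R) := forall x, B < `|x| -> f x = 0.

Lemma pd_vanish n B (f : 'rV[R]_n -> R) i : vanish B f -> vanish B (pd i f).
Proof.
move=> fB x Bx; rewrite /pd (@near_eq_derive _ _ _ f (cst 0)) ?derive_cst //.
have oB : open [set y : 'rV[R]_n | B < `|y|].
  rewrite -[X in open X]/((fun x : 'rV[R]_n => `|x|) @^-1` [set y | B < y]).
  by apply: open_comp => [y _|]; [exact: norm_continuous|exact: open_gt].
by apply: filterS (open_nbhs_nbhs (conj oB Bx)) => y /= /fB.
Qed.

Lemma bbs_vanish n B (f : 'rV[R]_n -> R) : 0 <= B -> continuous f -> vanish B f ->
  bbs n (fun s => f (rowS n s)).
Proof.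
move=> B0 cf fB; split; first exact: mseq_row.
have cBall : compact [set x : 'rV[R]_n | `|x| <= B].
  apply: bounded_closed_compact.
    by exists B; split; [exact: num_real|move=> M BM x /= /le_trans; apply; exact: ltW].
  rewrite -[X in closed X]/((fun x : 'rV[R]_n => `|x|) @^-1` [set y | y <= B]).
  apply: closed_comp => [x _|]; [exact: norm_continuous|exact: closed_le].
have [c _ fc] : exists2 c, c \in [set x : 'rV[R]_n | `|x| <= B] &
    forall t, t \in [set x : 'rV[R]_n | `|x| <= B] -> `|f t| <= `|f c|.
  apply: (EVT_max_rV (f := fun x => `|f x|)) => //.
    by exists 0; rewrite /= normr0.
  apply: continuous_subspaceT => x.
  by apply: continuous_comp; [exact: cf|exact: norm_continuous].
exists `|f c|, B; split => // [s sn|s sn].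
  case: (leP `|rowS n s| B) => sB; first by apply: fc; rewrite inE.
  by rewrite fB // normr0.
by rewrite (box_norm _ sn) // -ltNge => /fB.
Qed.

Definition Jv n (f : 'rV[R]_n -> R) := J n (fun s => f (rowS n s)).

Lemma intRdE n (f : 'rV[R]_n -> R) : bbs n (fun s => f (rowS n s)) ->
  intRd (fun x => (f x)%:E) = (Jv f)%:E.
Proof. by move=> bf; rewrite /intRd -[LHS]/(iint n (EFin \o _)) iintJ. Qed.

Lemma rowS_ins n (i : 'I_n.+1) y s : size s = n ->
  rowS n.+1 (ins i y s) = y *: delta_mx 0 i + rowS n.+1 (ins i 0 s).
Proof.
move=> sn; apply/rowP => j; have i_s : (i <= size s)%N by rewrite sn -ltnS ltn_ord.
rewrite !mxE eqxx /= !nth_ins //.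
case: (ltngtP j i) => ij; rewrite -val_eqE /= ?(ltn_eqF ij) ?(gtn_eqF ij) ?mulr0 ?add0r //.
by rewrite ij eqxx mulr1 addr0.
Qed.

(** With direction [i] integrated first, the fundamental theorem of calculus gives a difference of
    two values of [G] outside its support. *)
Lemma Jv_pd_eq0 n (G : 'rV[R]_n -> R) (i : 'I_n) (B : R) :
  0 <= B -> continuous (pd i G) -> vanish B G ->
  (forall x, derivable G x (delta_mx 0 i)) -> Jv (pd i G) = 0.
Proof.
case: n G i => [G []//|n] G i B0 cG GB dG.
have bG := bbs_vanish B0 cG (pd_vanish i GB).
rewrite /Jv (@J_ins _ _ _ i) //; last by rewrite -ltnS.
rewrite (@eq_J _ _ _ (fun=> 0)); last first.
  move=> s sn; under eq_Rintegral => y _ do rewrite rowS_ins //.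
  set r := rowS _ _.
  have line (y : R) : is_derive y 1 (fun y : R => G (y *: delta_mx 0 i + r))
      (pd i G (y *: delta_mx 0 i + r)).
    have /is_derive_lineP D := derivableP (dG (y *: delta_mx 0 i + r)).
    have {}D : is_derive (shift (- y) y) 1
      (fun h : R => G (h *: delta_mx 0 i + (y *: delta_mx 0 i + r)))
      (pd i G (y *: delta_mx 0 i + r)) by rewrite /= subrr.
    have := is_derive_comp (is_derive_shift y 1 (- y)) D.
    rewrite mulr1; congr is_derive; apply/funext => h /=.
    by rewrite addrA -scalerDl subrK.
  have yr (y : R) : `|y| <= `|y *: delta_mx 0 i + r|.
    apply: le_trans (ler_norm_coord _ i).
    have i_s : (i <= size s)%N by rewrite sn -ltnS ltn_ord.
    by rewrite !mxE !eqxx mulr1 nth_ins // ltnn eqxx addr0.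
  pose g y := pd i G (y *: delta_mx 0 i + r).
  have cg : continuous g.
    move=> y; apply: continuous_comp; last exact: cG.
    apply: cvgD; last exact: cvg_cst.
    by apply: cvgZl; exact: cvg_id.
  have gB (y : R) : B < `|y| -> g y = 0.
    by move=> By; apply: (pd_vanish i GB); exact: lt_le_trans (yr y).
  suff : (\int[mu]_x (g x)%:E = 0)%E by rewrite /Rintegral => ->.
  (* The endpoints are [B + 1] and its opposite because [vanish B] says nothing about points of norm
     exactly [B]. *)
  have -> : (\int[mu]_x (g x)%:E = \int[mu]_(x in `[(- (B + 1))%R, (B + 1)%R]) (g x)%:E)%E.
    rewrite [RHS]integral_mkcond; apply: eq_integral => y _.
    rewrite patchE; case: ifPn => // yB.
    rewrite gB // ltNge; apply: contra yB => yB.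
    rewrite inE /= in_itv /= -ler_norml; lra.
  rewrite (@continuous_FTC2 _ g (fun y => G (y *: delta_mx 0 i + r))).
  - rewrite !GB ?subee // ; apply: lt_le_trans (yr _).
    + by rewrite normrN ger0_norm; lra.
    + by rewrite ger0_norm; lra.
  - lra.
  - exact: continuous_subspaceT.
  - have cG' y : {for y, continuous (fun y : R => G (y *: delta_mx 0 i + r))}.
      by apply: differentiable_continuous; apply/derivable1_diffP; case: (line y).
    split.
    + by move=> y _; case: (line y).
    + by apply: cvg_at_right_filter; exact: cG'.
    + by apply: cvg_at_left_filter; exact: cG'.
  - by move=> y _; rewrite derive1E; case: (line y).
exact: J0.
Qed.
End RowVectors.

(** * Calculus rules for directional derivatives *)

Section PointwiseDerivatives.
Variables (R : realType) (V : normedModType R).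
Implicit Types (f g : V -> R) (x v : V) (a b : R).

Lemma is_derive_add f g x v a b : is_derive x v f a -> is_derive x v g b ->
  is_derive x v (fun x => f x + g x) (a + b).
Proof. by move=> ? ?; exact: is_deriveD. Qed.

Lemma is_derive_mul f g x v a b : is_derive x v f a -> is_derive x v g b ->
  is_derive x v (fun x => f x * g x) (f x * b + g x * a).
Proof. by move=> ? ?; exact: is_deriveM. Qed.

Lemma is_derive_const (c : R) x v : is_derive x v (fun=> c : R) 0.
Proof. exact: is_derive_cst. Qed.

Lemma is_derive_scale f c x v a : is_derive x v f a -> is_derive x v (fun x => c * f x) (c * a).
Proof. by move=> Df; have := is_derive_mul (is_derive_const c x v) Df; rewrite mulr0 addr0. Qed.

Lemma is_derive_bigsum n (f : 'I_n -> V -> R) x v (a : 'I_n -> R) :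
  (forall i, is_derive x v (f i) (a i)) ->
  is_derive x v (fun x => \sum_i f i x) (\sum_i a i).
Proof.
move=> Df; have := is_derive_sum Df; congr is_derive.
by apply/funext => y; rewrite fct_sumE.
Qed.

Lemma is_derive_inv f x v a : f x != 0 -> is_derive x v f a ->
  is_derive x v (fun x => (f x)^-1) (- (f x) ^- 2 * a).
Proof.
move=> fx0 [D1 D2]; split; first exact: derivableV.
by rewrite deriveV // D2.
Qed.

Lemma continuous_sum n (f : 'I_n -> V -> R) : (forall i, continuous (f i)) ->
  continuous (fun x => \sum_i f i x).
Proof.
elim: n f => [|n IH] f cf x.
  have -> : (fun x => \sum_(i < 0) f i x) = cst 0.
    by apply/funext => y; rewrite big_ord0.
  exact: cvg_cst.
have -> : (fun x => \sum_(i < n.+1) f i x) =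
    (fun x => f ord0 x + \sum_(i < n) f (lift ord0 i) x).
  by apply/funext => y; rewrite big_ord_recl.
by apply: cvgD; [exact: cf|apply: IH => i].
Qed.

End PointwiseDerivatives.

(** * The Euclidean norm and its square *)

Section EuclideanNorm.
Variable R : realType.
Implicit Type d : nat.

Definition sqn d (x : 'rV[R]_d) : R := \sum_i x ord0 i ^+ 2.

Lemma sqn_ge0 d (x : 'rV[R]_d) : 0 <= sqn x.
Proof. by apply: sumr_ge0 => i _; exact: sqr_ge0. Qed.

Lemma enorm_ge0 d (x : 'rV[R]_d) : 0 <= enorm x.
Proof. exact: sqrtr_ge0. Qed.

Lemma sqr_enorm d (x : 'rV[R]_d) : enorm x ^+ 2 = sqn x.
Proof. by rewrite sqr_sqrtr // sqn_ge0. Qed.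

(** The difference of the two sides is the variance of [a] under the weights [p]. *)
Lemma sqr_mean_le n (p a : 'I_n -> R) : (forall k, 0 <= p k) -> \sum_k p k = 1 ->
  (\sum_k p k * a k) ^+ 2 <= \sum_k p k * a k ^+ 2.
Proof.
move=> p0 p1; have E (m : R) : \sum_k p k * (a k - m) ^+ 2 =
    \sum_k p k * a k ^+ 2 - 2 * m * (\sum_k p k * a k) + m ^+ 2 * \sum_k p k.
  rewrite !mulr_sumr -sumrB -big_split /=; apply: eq_bigr => k _; ring.
have := E (\sum_k p k * a k); rewrite p1; set m := \sum_k p k * a k => {}E.
rewrite -subr_ge0.
have -> : \sum_k p k * a k ^+ 2 - m ^+ 2 = \sum_k p k * (a k - m) ^+ 2.
  by rewrite E; ring.
by apply: sumr_ge0 => k _; rewrite mulr_ge0 ?sqr_ge0.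
Qed.

Lemma Cauchy_Schwarz_sum n (a b : 'I_n -> R) :
  (\sum_k a k * b k) ^+ 2 <= (\sum_k a k ^+ 2) * (\sum_k b k ^+ 2).
Proof.
set B := \sum_k b k ^+ 2.
have B0 : 0 <= B by apply: sumr_ge0 => k _; exact: sqr_ge0.
have [b0|Bn0] := eqVneq B 0.
  have bk k : b k = 0.
    apply/eqP; rewrite -sqrf_eq0; apply/eqP.
    have := b0; rewrite /B => /eqP; rewrite psumr_eq0; last by move=> *; exact: sqr_ge0.
    by move=> /allP /(_ k); rewrite mem_index_enum => /(_ isT)/eqP.
  rewrite b0 mulr0 big1 ?expr0n // => k _; by rewrite bk mulr0.
have Bgt0 : 0 < B by rewrite lt_def Bn0.
have E (c : R) : \sum_k (a k - c * b k) ^+ 2 =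
    \sum_k a k ^+ 2 - 2 * c * (\sum_k a k * b k) + c ^+ 2 * \sum_k b k ^+ 2.
  rewrite !mulr_sumr -sumrB -big_split /=; apply: eq_bigr => k _; ring.
set S := \sum_k a k * b k.
have : 0 <= \sum_k (a k - S / B * b k) ^+ 2 by apply: sumr_ge0 => k _; exact: sqr_ge0.
rewrite E -/S -/B.
have -> : \sum_k a k ^+ 2 - 2 * (S / B) * S + (S / B) ^+ 2 * B =
  \sum_k a k ^+ 2 - S ^+ 2 / B by field.
by rewrite subr_ge0 ler_pdivrMr.
Qed.

Lemma enormD d (x y : 'rV[R]_d) : enorm (x + y) <= enorm x + enorm y.
Proof.
rewrite -(ler_pXn2r (ltn0Sn 1)) ?nnegrE ?addr_ge0 ?enorm_ge0 // sqr_enorm.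
rewrite sqrrD !sqr_enorm.
have -> : sqn (x + y) = sqn x + (\sum_i x ord0 i * y ord0 i) *+ 2 + sqn y.
  rewrite /sqn -sumrMnl -!big_split /=; apply: eq_bigr => i _; rewrite !mxE; ring.
rewrite lerD2r lerD2l lerMn2r /=.
apply: le_trans (ler_norm _) _.
rewrite -(ler_pXn2r (ltn0Sn 1)) ?nnegrE ?mulr_ge0 ?enorm_ge0 //.
rewrite exprMn !sqr_enorm real_normK ?num_real //; exact: Cauchy_Schwarz_sum.
Qed.

Lemma enormN d (x : 'rV[R]_d) : enorm (- x) = enorm x.
Proof. by congr Num.sqrt; apply: eq_bigr => i _; rewrite mxE sqrrN. Qed.

Lemma enormB_sym d (x y : 'rV[R]_d) : enorm (x - y) = enorm (y - x).
Proof. by rewrite -enormN opprB. Qed.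

Lemma norm_le_enorm d (x : 'rV[R]_d) : `|x| <= enorm x.
Proof.
apply: norm_rV_le; first exact: enorm_ge0.
move=> i; rewrite -(ler_pXn2r (ltn0Sn 1)) ?nnegrE ?enorm_ge0 //.
rewrite sqr_enorm real_normK ?num_real // /sqn (bigD1 i) //= lerDl.
by apply: sumr_ge0 => j _; exact: sqr_ge0.
Qed.

Lemma continuous_coord d (i : 'I_d) : continuous (fun x : 'rV[R]_d => x ord0 i).
Proof. by move=> x; exact: coord_continuous. Qed.

Lemma continuous_sqn d : continuous (@sqn d).
Proof.
apply: continuous_sum => i x.
by have c := @continuous_coord d i x; exact: (cvgM c c).
Qed.

Lemma continuous_enorm d : continuous (@enorm R d).
Proof.
move=> x; apply: (continuous_comp (f := @sqn d) (g := Num.sqrt)).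
  exact: continuous_sqn.
exact: sqrt_continuous.
Qed.

Lemma is_derive_coord d (i j : 'I_d) (x : 'rV[R]_d) :
  is_derive x (delta_mx 0 i) (fun x : 'rV[R]_d => x ord0 j) (i == j)%:R.
Proof.
apply/is_derive_lineP.
have -> : (fun h : R => (h *: delta_mx 0 i + x) ord0 j) =
    (fun h : R => (i == j)%:R * h + x ord0 j).
  by apply/funext => h; rewrite !mxE eqxx eq_sym mulrC.
have := is_derive_add (is_derive_scale (i == j)%:R (is_derive_id (0 : R) 1)) (is_derive_const (x ord0 j) (0 : R) 1).
by rewrite addr0 mulr1.
Qed.
End EuclideanNorm.

(** * Continuity of pointwise operations *)

Section PointwiseContinuity.
Variables (R : realType) (V : topologicalType).
Implicit Types f g : V -> R.

Lemma continuous_add f g : continuous f -> continuous g -> continuous (fun x => f x + g x).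
Proof. by move=> cf cg x; exact: (cvgD (cf x) (cg x)). Qed.

Lemma continuous_sub f g : continuous f -> continuous g -> continuous (fun x => f x - g x).
Proof. by move=> cf cg x; exact: (cvgB (cf x) (cg x)). Qed.

Lemma continuous_mul f g : continuous f -> continuous g -> continuous (fun x => f x * g x).
Proof. by move=> cf cg x; exact: (cvgM (cf x) (cg x)). Qed.

Lemma continuous_const (c : R) : continuous (fun _ : V => c).
Proof. by move=> x; exact: cvg_cst. Qed.

Lemma continuous_inv f : (forall x, f x != 0) -> continuous f -> continuous (fun x => (f x)^-1).
Proof. by move=> f0 cf x; exact: (cvgV (f0 x) (cf x)). Qed.

Lemma continuous_expn f n : continuous f -> continuous (fun x => f x ^+ n).
Proof.
move=> cf; elim: n => [|n IH]; first exact: continuous_const.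
have -> : (fun x => f x ^+ n.+1) = (fun x => f x * f x ^+ n).
  by apply/funext => x; rewrite exprS.
exact: continuous_mul.
Qed.

Lemma continuous_compose (h : R -> R) f : continuous h -> continuous f ->
  continuous (fun x => h (f x)).
Proof. by move=> ch cf x; apply: continuous_comp; [exact: cf|exact: ch]. Qed.

End PointwiseContinuity.

(** * The soft minimum of the squared distances to finitely many points *)

Section SoftMin.
Variables (R : realType) (d N : nat) (y : 'I_N.+1 -> 'rV[R]_d) (b : R).
Hypothesis b0 : 0 < b.
Implicit Types (x : 'rV[R]_d) (i j : 'I_d) (k : 'I_N.+1).

Let D k j x : R := (x - y k) ord0 j.
(** Gibbs weights at inverse temperature b/2 for the energies |x - y k|^2. Below, [Z] is their
    partition function, [p] the normalised weights, [m] the mean displacement and [C / Z] the matrix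
    of second moments. *)
Let e k x := expR (- (b / 2) * sqn (x - y k)).
Let W (w : 'I_N.+1 -> 'rV[R]_d -> R) x := \sum_k e k x * w k x.
Let Z := W (fun _ _ => 1).
Let A j := W (fun k => D k j).
Let C i j := W (fun k x => D k i x * D k j x).
Let m j x : R := A j x / Z x.

Let cont_D k j : continuous (D k j).
Proof.
have -> : D k j = (fun x => x ord0 j - y k ord0 j).
  by apply/funext => x; rewrite /D !mxE.
by apply: continuous_sub; [exact: continuous_coord|exact: continuous_const].
Qed.

Let deriv_D k i j x : is_derive x (delta_mx 0 i) (D k j) (i == j)%:R.
Proof.
have := is_derive_add (is_derive_coord i j x) (is_derive_const (- y k ord0 j) x (delta_mx 0 i)).
rewrite addr0; congr is_derive.
by apply/funext => z; rewrite /D !mxE.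
Qed.

Let cont_e k : continuous (e k).
Proof.
apply: (@continuous_compose _ _ (@expR R)); first exact: continuous_expR.
apply: continuous_mul; first exact: continuous_const.
by apply: continuous_sum => j; exact: (continuous_mul (@cont_D k j) (@cont_D k j)).
Qed.

Let deriv_e k i x : is_derive x (delta_mx 0 i) (e k) (e k x * (- b * D k i x)).
Proof.
have D1 : is_derive x (delta_mx 0 i) (fun x => sqn (x - y k)) (2 * D k i x).
  have := is_derive_bigsum (fun j => is_derive_mul (deriv_D k i j x) (deriv_D k i j x)).
  congr is_derive.
  rewrite (bigD1 i) //= eqxx big1 ?addr0 ?mulr1; first by ring.
  by move=> j ji; rewrite eq_sym (negbTE ji) mulr0 addr0.
have := is_derive_comp (is_derive_scale (- (b / 2)) D1) (is_derive_expR _).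
by congr is_derive; rewrite /e; field.
Qed.

Let cont_W w : (forall k, continuous (w k)) -> continuous (W w).
Proof.
by move=> cw; apply: continuous_sum => k; apply: continuous_mul; [exact: cont_e|exact: cw].
Qed.

Let deriv_W w dw i x : (forall k, is_derive x (delta_mx 0 i) (w k) (dw k)) ->
  is_derive x (delta_mx 0 i) (W w)
    (\sum_k e k x * (dw k - b * D k i x * w k x)).
Proof.
move=> Dw; have := is_derive_bigsum (fun k => is_derive_mul (deriv_e k i x) (Dw k)).
congr is_derive; apply: eq_bigr => k _; ring.
Qed.

Let Z_gt0 x : 0 < Z x.
Proof.
rewrite /Z /W big_ord_recl /= mulr1 ltr_pwDl ?expR_gt0 //.
by apply: sumr_ge0 => k _; rewrite mulr1 expR_ge0.
Qed.

Let cont_Z : continuous Z.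
Proof. by apply: cont_W => k; exact: continuous_const. Qed.

Let cont_A j : continuous (A j).
Proof. exact: cont_W. Qed.

Let cont_C i j : continuous (C i j).
Proof. by apply: cont_W => k; exact: (continuous_mul (@cont_D k i) (@cont_D k j)). Qed.

Let deriv_Z i x : is_derive x (delta_mx 0 i) Z (- b * A i x).
Proof.
have := deriv_W (fun k => is_derive_const (1 : R) x (delta_mx 0 i)); congr is_derive.
rewrite /A /W mulr_sumr; apply: eq_bigr => k _; ring.
Qed.

Let deriv_A i j x : is_derive x (delta_mx 0 i) (A j)
  ((i == j)%:R * Z x - b * C i j x).
Proof.
have := deriv_W (fun k => deriv_D k i j x); congr is_derive.
rewrite /Z /C /W !mulr_sumr -sumrB; apply: eq_bigr => k _; ring.
Qed.

Let cont_m j : continuous (m j).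
Proof.
by apply: continuous_mul => //; apply: continuous_inv => // x; rewrite gt_eqF.
Qed.

(** The matrix [C / Z - m m] is the covariance of the displacements under [p]. Its diagonal is
    nonnegative, so the diagonal derivatives are at most 1; this is the form in which concavity of q
    - |x|^2 is used. *)
Let deriv_m i j x : is_derive x (delta_mx 0 i) (m j)
  ((i == j)%:R - b * (C i j x / Z x - m i x * m j x)).
Proof.
have Zn0 : Z x != 0 by rewrite gt_eqF.
have := is_derive_mul (deriv_A i j x) (is_derive_inv Zn0 (deriv_Z i x)).
congr is_derive; rewrite /m; field.
by rewrite -/(Z x).
Qed.

Let p k x : R := e k x / Z x.

Let p_ge0 k x : 0 <= p k x.
Proof. by rewrite divr_ge0 ?expR_ge0 // ltW. Qed.

Let sum_p x : \sum_k p k x = 1.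
Proof.
rewrite -mulr_suml -[X in _ / X]/(Z x) /Z /W.
under [X in _ / X]eq_bigr do rewrite mulr1.
rewrite divff // gt_eqF //.
by have := Z_gt0 x; rewrite /Z /W; under eq_bigr do rewrite mulr1.
Qed.

Let mE j x : m j x = \sum_k p k x * D k j x.
Proof. by rewrite /m /A /W mulr_suml; apply: eq_bigr => k _; rewrite /p mulrAC. Qed.

Let sqr_m_le j x : m j x ^+ 2 <= \sum_k p k x * D k j x ^+ 2.
Proof. by rewrite mE; apply: sqr_mean_le => // k. Qed.

Let CE j x : C j j x / Z x = \sum_k p k x * D k j x ^+ 2.
Proof.
rewrite /C /W mulr_suml; apply: eq_bigr => k _; rewrite /p expr2; ring.
Qed.

(* The squared distance to the finite set [y], smoothed at scale [1/b]. *)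
Let q0 x : R := - (2 / b) * ln (Z x).

Let deriv_q0 i x : is_derive x (delta_mx 0 i) q0 (2 * m i x).
Proof.
have := is_derive_scale (- (2 / b)) (is_derive_comp (deriv_Z i x) (is_derive1_ln (Z_gt0 x))).
by congr is_derive; rewrite /m; field; rewrite !gt_eqF.
Qed.

Let q0_le k x : q0 x <= sqn (x - y k).
Proof.
have : ln (e k x) <= ln (Z x).
  rewrite ler_ln ?posrE ?expR_gt0 //.
  rewrite /Z /W (bigD1 k) //= mulr1 lerDl.
  by apply: sumr_ge0 => j _; rewrite mulr1 expR_ge0.
rewrite /e expRK /q0 => h.
rewrite mulNr lerNl; apply: le_trans (_ : 2 / b * (- (b / 2) * sqn (x - y k)) <= _).
  by rewrite le_eqVlt; apply/orP; left; apply/eqP; field; rewrite gt_eqF.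
by rewrite ler_pM2l // divr_gt0.
Qed.

(** Bounding every weight gives ln Z <= ln(N+1) - bc/2. The crude estimate ln(N+1) <= N+1 suffices,
    because [b] will be chosen after the net. *)
Let ge_q0 c x : (forall k, c <= sqn (x - y k)) -> c - 2 * N.+1%:R / b <= q0 x.
Proof.
move=> h.
have ZN : Z x <= N.+1%:R * expR (- (b / 2) * c).
  rewrite /Z /W; apply: le_trans (_ : \sum_(k < N.+1) expR (- (b / 2) * c) <= _).
    apply: ler_sum => k _; rewrite mulr1 /e ler_expR.
    by rewrite ler_nM2l // oppr_lt0 divr_gt0.
  by rewrite sumr_const card_ord mulr_natl.
have : ln (Z x) <= N.+1%:R - (b / 2) * c.
  apply: le_trans (_ : ln (N.+1%:R * expR (- (b / 2) * c)) <= _).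
    by rewrite ler_ln ?posrE ?mulr_gt0 ?expR_gt0.
  rewrite lnM ?posrE ?expR_gt0 // expRK mulNr lerD2r.
  by apply/ltW/ln_sublinear.
rewrite /q0 => hl; rewrite mulNr lerNr.
apply: le_trans (_ : 2 / b * (N.+1%:R - b / 2 * c) <= _).
  by rewrite ler_pM2l // divr_gt0.
by rewrite le_eqVlt; apply/orP; left; apply/eqP; field; rewrite gt_eqF.
Qed.

(* Each summand [- p ln p] of the entropy is at most one. *)
Let entropy x : \sum_k p k x * sqn (x - y k) <= q0 x + 2 * N.+1%:R / b.
Proof.
have -> : q0 x + 2 * N.+1%:R / b = \sum_k (p k x * q0 x + 2 / b).
  rewrite big_split /= -mulr_suml sum_p mul1r sumr_const card_ord.
  by rewrite -mulr_natr; congr +%R; ring.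
apply: ler_sum => k _.
have pk : 0 < p k x by rewrite divr_gt0 ?expR_gt0.
have lnp : ln (p k x) = - (b / 2) * sqn (x - y k) - ln (Z x).
  by rewrite /p ln_div ?posrE ?expR_gt0 // /e expRK.
have -> : sqn (x - y k) = q0 x - 2 / b * ln (p k x).
  by rewrite lnp /q0; field; rewrite gt_eqF.
rewrite mulrBr lerD2l mulrCA -mulrN -[leRHS]mulr1 ler_pM2l ?divr_gt0 //.
have : ln (p k x)^-1 <= (p k x)^-1 - 1.
  by have := @le_ln1Dx R ((p k x)^-1 - 1); rewrite subrKC; apply; rewrite ltrBrDl subrr invr_gt0.
rewrite lnV ?posrE // -mulrN => h.
apply: le_trans (_ : p k x * ((p k x)^-1 - 1) <= _); first by rewrite ler_pM2l.
by rewrite mulrBr mulfV ?gt_eqF // mulr1 gerBl ltW.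
Qed.

Lemma soft_min : exists (q : 'rV[R]_d -> R) (m : 'I_d -> 'rV[R]_d -> R)
    (h : 'I_d -> 'I_d -> 'rV[R]_d -> R),
  [/\ forall j, continuous (m j), forall i j, continuous (h i j),
      forall i x, is_derive x (delta_mx 0 i) q (2 * m i x),
      forall i j x, is_derive x (delta_mx 0 i) (m j) (h i j x) &
      forall j x, h j j x <= 1] /\
  [/\ continuous q, forall x, \sum_j m j x ^+ 2 <= q x,
      forall k x, q x <= sqn (x - y k) + 4 * N.+1%:R / b &
      forall c x, (forall k, c <= sqn (x - y k)) -> c + 2 * N.+1%:R / b <= q x].
Proof.
(* Half of the shift pays for the entropy in |m|^2 <= q, and also for [ge_q0]. The other half keeps
   [q] strictly above the smallest squared distance, hence positive even on the net, so that its
   square root is differentiable everywhere. *)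
exists (fun x => q0 x + 4 * N.+1%:R / b), m,
  (fun i j x => (i == j)%:R - b * (C i j x / Z x - m i x * m j x)).
have cZV : continuous (fun x => (Z x)^-1) by apply: continuous_inv => // x; rewrite gt_eqF.
split; split.
- exact: cont_m.
- move=> i j; apply: continuous_sub; first exact: continuous_const.
  apply: continuous_mul; first exact: continuous_const.
  by apply: continuous_sub; [exact: continuous_mul|exact: continuous_mul].
- move=> i x; have := is_derive_add (deriv_q0 i x) (is_derive_const (4 * N.+1%:R / b) x (delta_mx 0 i)).
  by rewrite addr0.
- by move=> i j x; exact: deriv_m.
- move=> j x; rewrite eqxx gerBl; apply: mulr_ge0; first exact: ltW.
  rewrite CE subr_ge0 -expr2.
  exact: sqr_m_le.
- apply: continuous_add; last exact: continuous_const.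
  apply: continuous_mul; first exact: continuous_const.
  move=> x; apply: (continuous_comp (f := Z)); first exact: cont_Z.
  exact: continuous_ln.
- move=> x; apply: le_trans (_ : \sum_k p k x * sqn (x - y k) <= _).
    under [leRHS]eq_bigr do rewrite mulr_sumr.
    rewrite exchange_big /=; apply: ler_sum => j _; exact: sqr_m_le.
  apply: le_trans (entropy x) _; rewrite lerD2l ler_pM2r ?invr_gt0 //.
  by rewrite ler_pM2r // ler_nat.
- by move=> k x; rewrite lerD2r.
- move=> c x /ge_q0 h; rewrite -lerBlDr; apply: le_trans h.
  by rewrite le_eqVlt; apply/orP; left; apply/eqP; field; rewrite gt_eqF.
Qed.
End SoftMin.

(** * Tail integrals in one variable *)

Section Tail.
Variable R : realType.
Local Notation mu := (@lebesgue_measure R).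

Definition tail (w : R -> R) (r : R) : R := \int[mu]_(t in `[r, +oo[) w t.

Variables (w : R -> R) (M T : R).
Hypothesis mw : measurable_fun setT w.
Hypothesis wM : forall t, `|w t| <= M.
Hypothesis wT : forall t, T < `|t| -> w t = 0.

Let iw : mu.-integrable setT (EFin \o w).
Proof. exact: bounded_itv_integrable wM wT. Qed.

Let M0 : 0 <= M. Proof. exact: le_trans (normr_ge0 _) (wM 0). Qed.

(** Passing to the complementary half-line reduces [tail_deriv] to the fundamental theorem for a
    variable upper endpoint. *)
Lemma tailE r : tail w r = \int[mu]_t w t - \int[mu]_(t in `]-oo, r]) w t.
Proof.
have iwE : mu.-integrable [set` Interval -oo%O +oo%O] (EFin \o w).
  by rewrite set_itvNyy.
have := @Rintegral_itvB R w -oo%O +oo%O r iwE isT isT.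
rewrite set_itvNyy => ->; rewrite /tail Rintegral_itv_obnd_cbnd //.
exact: integrableS iw.
Qed.

Lemma tail_indic r : tail w r = \int[mu]_t (if r <= t then w t else 0).
Proof.
rewrite /tail Rintegral_mkcond; apply: eq_Rintegral => t _.
by rewrite patchE; case: ifPn; rewrite ?inE ?notin_setE /= in_itv /= andbT;
  case: ifP.
Qed.

Lemma tail_deriv (r : R) : {for r, continuous w} -> is_derive r 1 (tail w) (- w r).
Proof.
move=> cw.
have iwr : mu.-integrable [set` Interval -oo%O (BRight (r + 1))] (EFin \o w).
  exact: integrableS iw.
have r1 : r < r + 1 by rewrite ltrDl.
have [|//|D1 D2] := continuous_FTC1 r1 iwr; first by rewrite ltNyr.
have D3 : is_derive r 1 (fun r => \int[mu]_(t in `]-oo, r]) w t) (w r).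
  by split; [exact: D1|rewrite -D2 derive1E].
have := is_derive_add (is_derive_const (\int[mu]_t w t) r 1) (is_derive_scale (-1) D3).
rewrite add0r mulN1r; congr is_derive.
by apply/funext => t; rewrite tailE mulN1r.
Qed.

Lemma tail_full r : (forall t, t < r -> w t = 0) -> tail w r = \int[mu]_t w t.
Proof.
move=> w0; rewrite tail_indic; apply: eq_Rintegral => t _.
by case: leP => // /w0.
Qed.

Lemma tail_eq0 r : (forall t, r <= t -> w t = 0) -> tail w r = 0.
Proof.
move=> w0; rewrite tail_indic -[RHS](mul0r (fine (mu setT))) -Rintegral_cst //.
by apply: eq_Rintegral => t _; case: leP => // /w0.
Qed.

Lemma tail_ge0 r : (forall t, 0 <= w t) -> 0 <= tail w r.
Proof. by move=> w0; apply: Rintegral_ge0. Qed.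

Lemma tail_lipschitz r r' : continuous w -> `|tail w r - tail w r'| <= M * `|r - r'|.
Proof.
move=> cw.
have key a b : a < b -> `|tail w a - tail w b| <= M * `|a - b|.
  move=> ab; have D (x : R) : is_derive x 1 (tail w) (- w x) by apply: tail_deriv; exact: cw.
  have c_tail : {within `[a, b], continuous (tail w)}.
    apply: continuous_subspaceT => x; apply: differentiable_continuous.
    by apply/derivable1_diffP; case: (D x).
  have [c _ E] := MVT ab (fun x _ => D x) c_tail.
  by rewrite distrC E normrM normrN [`|a - b|]distrC ler_wpM2r.
have [rr'|rr'|->] := ltgtP r r'; first exact: key.
- by rewrite distrC [`|r - r'|]distrC; exact: key.
- by rewrite !subrr normr0 mulr0.
Qed.

End Tail.

(** * Monotonicity of iterated integrals of nonnegative functions *)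

Section MonotoneIterated.
Variable R : realType.
Local Notation mu := (@lebesgue_measure R).
Local Open Scope ereal_scope.

(* The integral of a nonnegative function is a supremum over the simple
   functions below it, hence monotone even without measurability. *)
Lemma le_integral_ge0 d (T : measurableType d) (m : {measure set T -> \bar R})
    (f g : T -> \bar R) :
  (forall x, 0 <= f x) -> (forall x, f x <= g x) ->
  \int[m]_x f x <= \int[m]_x g x.
Proof.
move=> f0 fg; have g0 x : 0 <= g x by exact: le_trans (f0 x) (fg x).
rewrite !ge0_integralTE //; apply: le_ereal_sup => _ [h hf <-].
by exists h => // x; exact: le_trans (hf x) (fg x).
Qed.

Lemma iint_ge0 n (f : seq R -> \bar R) : (forall s, 0 <= f s) -> 0 <= iint n f.
Proof.
elim: n f => [|n IH] f f0 /=; first exact: f0.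
by apply: integral_ge0 => x _; apply: IH => s.
Qed.

Lemma le_iint n (f g : seq R -> \bar R) :
  (forall s, 0 <= f s) -> (forall s, f s <= g s) -> iint n f <= iint n g.
Proof.
elim: n f g => [|n IH] f g f0 fg /=; first exact: fg.
by apply: le_integral_ge0 => x; [apply: iint_ge0 => s|apply: IH => s].
Qed.

End MonotoneIterated.

(** * Functions of class C1 vanishing outside a ball, as members of D1 *)

Section SobolevC1.
Variables (R : realType) (n : nat).
Implicit Types u f g : 'rV[R]_n -> R.

Lemma cpt_supp_vanish f : cpt_supp f -> exists2 B, 0 <= B & vanish B f.
Proof.
move=> /compact_bounded[M [_ fM]]; exists (`|M| + 1); first by rewrite addr_ge0.
move=> x Mx; apply/eqP; apply: contraTT Mx => fx; rewrite -leNgt.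
by apply: (fM (`|M| + 1)); [rewrite ltr_pwDr // ler_norm|exact: subset_closure].
Qed.

Lemma borel_fun_continuous f : continuous f -> borel_fun f.
Proof. by move=> cf B oB; apply: sub_sigma_algebra; apply: open_comp. Qed.

Lemma intRd_lty B f g : 0 <= B -> continuous f -> vanish B f -> (forall x, 0 <= g x) ->
  (forall x, g x <= `|f x|) -> (intRd (fun x => (g x)%:E) < +oo)%E.
Proof.
move=> B0 cf fB g0 gf.
apply: (@le_lt_trans _ _ (intRd (fun x => (`|f x|)%:E))).
  by apply: le_iint => s; rewrite lee_fin.
rewrite intRdE ?ltry //; exact: bbs_norm (bbs_vanish B0 cf fB).
Qed.

Lemma JvD f g : bbs n (fun s => f (rowS n s)) -> bbs n (fun s => g (rowS n s)) ->
  Jv (fun x => f x + g x) = Jv f + Jv g.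
Proof. exact: JD. Qed.

(** Integration by parts against [phi] is [Jv_pd_eq0] for the product [u * phi], whose support is
    controlled by that of [u]. *)
Lemma C1_in_D1 u (g : 'I_n -> 'rV[R]_n -> R) (B : R) : 0 <= B -> vanish B u ->
  continuous u -> (forall i, continuous (g i)) ->
  (forall i x, is_derive x (delta_mx 0 i) u (g i x)) ->
  in_D1 u g /\
  intRd (fun x => (\sum_i g i x ^+ 2)%:E) = (Jv (fun x => \sum_i g i x ^+ 2))%:E.
Proof.
move=> B0 uB cu cg ug.
have pdu i : pd i u = g i by apply/funext => x; rewrite /pd; case: (ug i x).
have gB i : vanish B (g i) by rewrite -pdu; exact: pd_vanish.
have locC f : continuous f -> vanish B f -> loc_int f.
  move=> cf fB; split; first exact: borel_fun_continuous.
  move=> C _; apply: (intRd_lty B0 cf fB) => x.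
    by rewrite mulr_ge0 // indicE.
  by rewrite indicE; case: (_ \in _); rewrite ?mul1r ?mul0r.
have cg2 : continuous (fun x => \sum_i g i x ^+ 2).
  by apply: continuous_sum => i; exact: continuous_expn.
have E : intRd (fun x => (\sum_i g i x ^+ 2)%:E) = (Jv (fun x => \sum_i g i x ^+ 2))%:E.
  apply: intRdE; apply: (bbs_vanish (f := fun x => \sum_i g i x ^+ 2) B0) => // x Bx.
  by rewrite big1 // => i _; rewrite gB // expr0n.
split=> //; split.
- exact: locC.
- move=> i; split; first exact: locC.
  move=> phi sphi /cpt_supp_vanish[B' B'0 phiB'].
  have [cphi dphi] := sphi [::]; have [cdphi _] := sphi [:: i].
  have b1 : bbs n (fun s => u (rowS n s) * pd i phi (rowS n s)).
    apply: (bbs_vanish (f := fun x => u x * pd i phi x) B0); first exact: continuous_mul.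
    by move=> x Bx; rewrite uB // mul0r.
  have b2 : bbs n (fun s => g i (rowS n s) * phi (rowS n s)).
    apply: (bbs_vanish (f := fun x => g i x * phi x) B0); first exact: continuous_mul.
    by move=> x Bx; rewrite gB // mul0r.
  rewrite (intRdE b1) (intRdE b2) -EFinN; congr EFin; apply/eqP.
  rewrite -addr_eq0; apply/eqP; rewrite -JvD //.
  have D x : is_derive x (delta_mx 0 i) (fun x => u x * phi x)
      (u x * pd i phi x + g i x * phi x).
    have := is_derive_mul (ug i x) (derivableP (dphi i x)); congr is_derive.
    by rewrite [phi x * _]mulrC.
  have <- : pd i (fun x => u x * phi x) = (fun x => u x * pd i phi x + g i x * phi x).
    by apply/funext => x; rewrite /pd; case: (D x).
  apply: (Jv_pd_eq0 B0).
  + have -> : pd i (fun x => u x * phi x) = (fun x => u x * pd i phi x + g i x * phi x).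
      by apply/funext => x; rewrite /pd; case: (D x).
    by apply: continuous_add; exact: continuous_mul.
  + by move=> x Bx; rewrite uB // mul0r.
  + by move=> x; case: (D x).
- by rewrite E ltry.
(* Chebyshev: the indicator of |u| > eps is at most |u| / eps. *)
- move=> eps eps0; apply: (@intRd_lty B (fun x => eps^-1 * u x)) => //.
  + by apply: continuous_mul => //; exact: continuous_const.
  + by move=> x Bx; rewrite uB // mulr0.
  + move=> x; rewrite indicE.
    have [|_] := boolP (x \in _); last exact: normr_ge0.
    rewrite inE /= => ux; rewrite normrM gtr0_norm ?invr_gt0 // mulrC.
    by rewrite ler_pdivlMr // mul1r ltW.
Qed.
End SobolevC1.

(** * Filled sets, the distance function and finite nets *)

Section FilledSets.
Variables (R : realType) (d : nat).
Implicit Types (K A : set 'rV[R]_d) (x y : 'rV[R]_d).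

Lemma sub_fill K : K `<=` fill K.
Proof. by move=> x Kx []. Qed.

Lemma line_continuous x v : continuous (fun t : R => x + t *: v).
Proof.
move=> t; apply: cvgD; first exact: cvg_cst.
by apply: cvgZl; exact: cvg_id.
Qed.

Lemma connected_line x v (i : interval R) :
  connected ((fun t : R => x + t *: v) @` [set` i]).
Proof.
apply: connected_continuous_connected; last first.
  exact/continuous_subspaceT/line_continuous.
exact/connected_intervalP/interval_is_interval.
Qed.

(** The outward ray from [x] avoids [K], is connected and unbounded, hence lies in an unbounded
    component. *)
Lemma unbdd_comp_far K (B : R) x : 0 <= B -> (forall z, K z -> `|z| <= B) ->
  B < `|x| -> unbdd_comp K x.
Proof.
move=> B0 KB Bx; have x0 : 0 < `|x| by exact: le_lt_trans Bx.
have normE (t : R) : 0 <= t -> `|x + t *: x| = (1 + t) * `|x|.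
  by move=> t0; rewrite -{1}[x]scale1r -scalerDl normrZ ger0_norm ?addr_ge0.
have nK (t : R) : 0 <= t -> ~ K (x + t *: x).
  move=> t0 /KB; rewrite normE // leNgt => /negP; apply.
  by apply: lt_le_trans Bx _; rewrite ler_peMl // lerDl.
split; first by have := nK 0 (lexx _); rewrite scale0r addr0.
move=> [M [_ hM]].
(* With this [t] the point [x + t *: x] has norm |x| + |M| + 1, beyond the supposed bound. *)
pose t := (`|M| + 1) / `|x|.
have t0 : 0 <= t by rewrite divr_ge0 // addr_ge0.
have : connected_component (~` K) x (x + t *: x).
  apply: (@connected_component_max _ _ ((fun t : R => x + t *: x) @` `[0, +oo[)).
  - by exists 0; rewrite /= ?in_itv /= ?lexx // scale0r addr0.
  - by move=> _ [s s0 <-]; apply: nK; move: s0; rewrite /= in_itv /= andbT.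
  - exact: connected_line.
  - by exists t => //=; rewrite in_itv /= t0.
move=> /(hM (`|M| + 1)); rewrite ltr_pwDr ?ler_norm // => /(_ isT).
apply/negP; rewrite -ltNge normE // mulrDl mul1r /t divfK ?gt_eqF //.
by rewrite ltrDr.
Qed.

(** In a ball around [x] disjoint from [K], a segment joins [x] to every other point, so both have
    the same component. *)
Lemma open_unbdd_comp K : closed K -> open (unbdd_comp K).
Proof.
move=> cK; rewrite openE => x [Kx ux].
have [e /= e0 eK] : nbhs_ball x (~` K).
  by apply/nbhs_ballP; apply: open_nbhs_nbhs; split => //; exact: closed_openC.
apply/nbhs_ballP; exists e => //= z; rewrite mx_norm_ball /ball_ /= => xz.
have seg t : t \in `[0, 1] -> (~` K) (x + t *: (z - x)).
  rewrite in_itv /= => /andP[t0 t1]; apply: eK; rewrite mx_norm_ball /ball_ /=.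
  rewrite opprD addNKr normrN normrZ ger0_norm // distrC.
  by apply: le_lt_trans xz; rewrite ler_piMl.
have Kz : (~` K) z.
  by have := seg 1; rewrite scale1r subrKC; apply; rewrite in_itv /= ler01 lexx.
split=> //; suff <- : connected_component (~` K) x = connected_component (~` K) z by [].
apply: same_connected_component.
apply: (@connected_component_max _ _ ((fun t : R => x + t *: (z - x)) @` `[0, 1])).
- by exists 0; rewrite /= ?in_itv /= ?lexx ?ler01 // scale0r addr0.
- by move=> _ [s /= s01 <-]; exact: seg.
- exact: connected_line.
- by exists 1; rewrite /= ?in_itv /= ?lexx ?ler01 // scale1r subrKC.
Qed.

Lemma compact_norm_bound K : compact K ->
  exists2 B : R, 0 <= B & forall x, K x -> `|x| <= B.
Proof.
move=> /compact_bounded[M [_ hM]]; exists (`|M| + 1); first by rewrite addr_ge0.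
by move=> x Kx; apply: (hM (`|M| + 1)) => //; rewrite ltr_pwDr // ler_norm.
Qed.

Lemma compact_fill K : compact K -> compact (fill K).
Proof.
move=> cK; have [B B0 KB] := compact_norm_bound cK.
apply: bounded_closed_compact; last first.
  apply: open_closedC; apply: open_unbdd_comp; apply: compact_closed => //.
exists B; split; first exact: num_real.
move=> M BM x fx /=; rewrite leNgt; apply/negP => Mx; apply: fx.
by apply: (unbdd_comp_far B0 KB); exact: lt_trans Mx.
Qed.

Lemma continuous_enormB x : continuous (fun y => enorm (x - y)).
Proof.
move=> y; apply: (continuous_comp (f := fun y => x - y)); last exact: continuous_enorm.
by apply: continuousB; [exact: cst_continuous|move=> ?].
Qed.

(** Since the minimum is attained, the sublevel sets of [D] are exactly the closed neighbourhoods
    [nbhd_closed A t]. *)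
Lemma dist_exists A : compact A -> A !=set0 ->
  exists D : 'rV[R]_d -> R, [/\ continuous D,
    forall x, exists2 a, A a & D x = enorm (x - a) &
    forall x a, A a -> D x <= enorm (x - a)].
Proof.
move=> cA A0.
have /choice[c hc] x : exists c, A c /\ forall a, A a -> enorm (x - c) <= enorm (x - a).
  have [c cA' hc] := EVT_min_rV A0 cA (continuous_subspaceT (@continuous_enormB x)).
  by exists c; split => [|a Aa]; [rewrite inE in cA'|apply: hc; rewrite inE].
pose D x := enorm (x - c x).
have Dlip x z : D x <= D z + enorm (x - z).
  apply: le_trans ((hc x).2 (c z) (hc z).1) _; rewrite [leRHS]addrC /D.
  have -> : x - c z = (x - z) + (z - c z) by rewrite addrA subrK.
  exact: enormD.
have c_dist (x : 'rV[R]_d) : {for x, continuous D}.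
  apply/(@cvgrPdist_lt _ _ _ _ (nbhs_filter x)) => e e0.
  have oU : open [set z | enorm (x - z) < e].
    rewrite -[X in open X]/((fun z => enorm (x - z)) @^-1` [set y | y < e]).
    by apply: open_comp => [z _|]; [exact: continuous_enormB|exact: open_lt].
  have Ux : [set z | enorm (x - z) < e] x.
    by rewrite /= subrr /enorm big1 ?sqrtr0 // => i _; rewrite mxE expr0n.
  apply: filterS (open_nbhs_nbhs (conj oU Ux)) => z /= xz.
  apply: le_lt_trans xz; rewrite ler_norml; apply/andP; split.
    by rewrite lerNl opprB lerBlDl enormB_sym.
  by rewrite lerBlDl.
exists D; split => [x|x|x a]; [exact: c_dist| |exact: (hc x).2].
by exists (c x); [exact: (hc x).1|].
Qed.

Lemma finite_net A (e : R) : compact A -> A !=set0 -> 0 < e ->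
  exists N (y : 'I_N.+1 -> 'rV[R]_d), (forall k, A (y k)) /\
    forall a, A a -> exists k, enorm (a - y k) < e.
Proof.
move=> cA [a0 Aa0] e0; rewrite compact_cover in cA.
have [|a Aa|D DA cov] := cA 'rV[R]_d A (fun y => [set z | enorm (y - z) < e]).
- move=> y _; rewrite -[X in open X]/((fun z => enorm (y - z)) @^-1` [set y | y < e]).
  by apply: open_comp => [z _|]; [exact: continuous_enormB|exact: open_lt].
- exists a => //=; rewrite subrr /enorm big1 ?sqrtr0 // => i _; rewrite mxE expr0n //.
(* Prepending [a0] makes the net visibly nonempty, as the index type requires; for the soft minimum
   this is what makes [Z] positive. *)
pose s := a0 :: finmap.enum_fset D.
exists (size (finmap.enum_fset D)), (fun k => nth a0 s k); split.
  move=> k; have : nth a0 s k \in s by exact: mem_nth.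
  rewrite inE => /orP[/eqP -> //|].
  by move=> /DA; rewrite inE.
move=> a Aa; have [y /= yD ya] := cov _ Aa.
have ys : y \in s by rewrite inE yD orbT.
have hi : (index y s < (size (finmap.enum_fset D)).+1)%N by rewrite index_mem.
by exists (Ordinal hi); rewrite /= nth_index // enormB_sym.
Qed.

End FilledSets.

(** * Integrands with one additional level variable *)

Section MoreIterated.
Variable R : realType.
Local Notation mu := (@lebesgue_measure R).

Lemma mseq_head n : mseq n.+1 (fun s : seq R => head 0 s).
Proof. by move=> dd T [//|q p] pn mp; exact: (mp 0%N). Qed.

Lemma mseq_behead n (f : seq R -> R) : mseq n f -> mseq n.+1 (fun s => f (behead s)).
Proof.
move=> mf dd T [//|q p] [pn] mp; apply: mf => // i; exact: (mp i.+1).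
Qed.

(** The head of the sequence is a level t and the rest a point x; with [I] the indicator of
    [D x <= t], this is the integrand on which [flux_integral] applies Fubini. *)
Lemma bbs_tensor n (w : R -> R) (M T : R) (I f : seq R -> R) :
  measurable_fun setT w -> (forall t, `|w t| <= M) -> (forall t, T < `|t| -> w t = 0) ->
  mseq n.+1 I -> (forall s, size s = n.+1 -> `|I s| <= 1) -> bbs n f ->
  bbs n.+1 (fun s => w (head 0 s) * (I s * f (behead s))).
Proof.
move=> mw wM wT mI I1 [mf [M' [B [M'0 B0 fM fB]]]].
have M0 : 0 <= M by exact: le_trans (normr_ge0 _) (wM 0).
split.
  apply: mseqM; first by apply: mseq_comp => //; exact: mseq_head.
  by apply: mseqM => //; exact: mseq_behead.
exists (M * M'), (Num.max B T); split; rewrite ?mulr_ge0 ?le_max ?B0 //.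
  move=> [//|t s] [sn] /=; rewrite normrM ler_pM //.
  by rewrite normrM -[leRHS]mul1r ler_pM ?I1 ?fM //= sn.
move=> [//|t s] [sn]; rewrite negb_and -ltNge gt_max => /orP[/andP[_ tT]|sB] /=.
  by rewrite wT // mul0r.
rewrite fB ?mulr0 //; apply: contra sB; apply: box_le.
by rewrite le_max lexx.
Qed.

Lemma measurable_J n (f : seq R -> R) : bbs n.+1 f ->
  measurable_fun setT (fun x : R => J n (fun s => f (x :: s))).
Proof.
elim: n f => [|n IH] f bf.
  by case: bf => mf _; exact: (mseq_rcons1 (s := [::]) mf).
have -> : (fun x => J n.+1 (fun s => f (x :: s))) =
    (fun x => J n (fun s => int_last f (x :: s))).
  by apply/funext => x; rewrite JS //; exact: bbs_cons.
exact: (IH _ (bbs_int_last bf)).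
Qed.

Lemma J_sum n m (f : 'I_m -> seq R -> R) : (forall i, bbs n (f i)) ->
  bbs n (fun s => \sum_i f i s) /\ J n (fun s => \sum_i f i s) = \sum_i J n (f i).
Proof.
elim: m f => [|m IH] f bf.
  have E : (fun s => \sum_(i < 0) f i s) = (fun=> 0).
    by apply/funext => s; rewrite big_ord0.
  by rewrite E J0 big_ord0; split => //; exact: bbs0.
have E : (fun s => \sum_(i < m.+1) f i s) =
    (fun s => f ord0 s + \sum_(i < m) f (lift ord0 i) s).
  by apply/funext => s; rewrite big_ord_recl.
have [b1 E1] := IH (fun i => f (lift ord0 i)) (fun i => bf _).
rewrite E big_ord_recl -E1 -JD //; split => //; exact: bbsD.
Qed.

Lemma measurable_le_nat (t : R) : measurable_fun setT (fun y : R => (y <= t)%R%:R : R).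
Proof.
have -> : (fun y : R => (y <= t)%R%:R : R) = \1_(`]-oo, t]%classic : set R).
  apply/funext => y; rewrite indicE; congr (_%:R); congr nat_of_bool.
  by apply/idP/idP; rewrite inE /= in_itv.
by apply: measurable_indic; exact: measurable_itv.
Qed.

End MoreIterated.

Lemma continuous_opp (R : realType) (V : topologicalType) (f : V -> R) :
  continuous f -> continuous (fun x => - f x).
Proof. by move=> cf x; exact: (cvgN (cf x)). Qed.

(** * The positive part and its square *)

Section PositivePart.
Variable R : realType.

Definition pp (v : R) : R := Num.max 0 v.

Lemma pp_ge0 v : 0 <= pp v. Proof. by rewrite le_max lexx. Qed.

Lemma pp_continuous : continuous pp.
Proof.
move=> v; rewrite /pp.
have -> : (fun v : R => Num.max 0 v) = (fun v => (v + `|v|) / 2).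
  apply/funext => z; case: (leP 0 z) => z0.
    by rewrite ger0_norm //; field.
  by rewrite ltr0_norm // subrr mul0r.
suff : continuous (fun v : R => (v + `|v|) / 2) by apply.
apply: continuous_mul; last exact: continuous_const.
apply: continuous_add; first by move=> z.
by move=> z; exact: (@norm_continuous R R).
Qed.

(** Squaring removes the corner of the positive part at 0. A cutoff built this way is C1, as the
    test fields in [perimeter] must be. *)
Lemma pp_sqr_deriv (v : R) : is_derive v 1 (fun v => pp v ^+ 2) (2 * pp v).
Proof.
have [v0|v0|->] := ltgtP v 0.
- apply: (@near_eq_is_derive _ _ _ (fun=> 0)).
    near=> z; rewrite /pp max_l ?expr0n //.
    by apply/ltW; near: z; exact: lt_nbhsl.
  by rewrite /pp max_l ?mulr0 ?ltW //; exact: is_derive_const.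
- apply: (@near_eq_is_derive _ _ _ (fun z : R => z * z)).
    near=> z; rewrite /pp max_r ?expr2 //.
    by apply/ltW; near: z; exact: lt_nbhsr.
  have := is_derive_mul (is_derive_id v 1) (is_derive_id v (1 : R)).
  by rewrite /pp max_r ?ltW // mulr1 mulr_natl mulr2n.
(* At 0 the difference quotient of the square is [pp] itself, which tends to 0. *)
- have E : (fun h : R => h^-1 *: (((fun v => pp v ^+ 2) \o shift 0) (h *: 1) - pp 0 ^+ 2))
      @ 0^' --> (0 : R).
    have c0 : pp h @[h --> (0 : R)^'] --> (0 : R).
      have := @pp_continuous (0 : R); rewrite /continuous_at {2}/pp maxxx.
      by move=> h; apply: cvg_trans h; apply: cvg_app; exact: cvg_within.
    apply: cvg_trans c0; apply: near_eq_cvg; near=> h.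
    have h0 : h != 0 by near: h; exact: nbhs_dnbhs_neq.
    have pp0 : pp 0 = 0 by rewrite /pp maxxx.
    rewrite /= addr0 [h *: 1]mulr1 pp0 expr0n subr0.
    rewrite /pp; case: (leP 0 h) => hh; last by rewrite expr0n /= scaler0.
    by rewrite expr2 scalerA mulVf // scale1r.
  split; first by apply/cvg_ex; exists 0.
  by rewrite /pp maxxx mulr0; exact: cvg_lim E.
Unshelve. all: by end_near. Qed.

End PositivePart.

Lemma le_of_sqr (R : realDomainType) (x y : R) : 0 <= y -> x ^+ 2 <= y ^+ 2 -> x <= y.
Proof.
move=> y0 xy; rewrite leNgt; apply: contraTN xy => yx.
by rewrite -ltNge ltr_pXn2r // nnegrE // (le_trans y0) // ltW.
Qed.

(** * The test field, its flux through neighbourhoods of the set, and the energy of the potential *)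

Section Energy.
Variables (R : realType) (d : nat) (A : set 'rV[R]_d) (D : 'rV[R]_d -> R).
Variables (a s T : R).
Hypotheses (a0 : 0 <= a) (s0 : 0 < s) (sT : s <= T).
Hypotheses (cD0 : continuous D) (D_ge0 : forall x, 0 <= D x).
Hypothesis DA : forall t x, nbhd_closed A t x <-> D x <= t.
Hypothesis Da : forall x, `|x| <= a + D x.

Variables (q : 'rV[R]_d -> R) (m : 'I_d -> 'rV[R]_d -> R).
Variable h : 'I_d -> 'I_d -> 'rV[R]_d -> R.
Hypotheses (cq : continuous q) (cm : forall j, continuous (m j)).
Hypothesis ch : forall i j, continuous (h i j).
Hypothesis deriv_q : forall i x, is_derive x (delta_mx 0 i) q (2 * m i x).
Hypothesis deriv_m : forall i j x, is_derive x (delta_mx 0 i) (m j) (h i j x).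
Hypothesis h_le1 : forall j x, h j j x <= 1.
Hypothesis m_le_q : forall x, \sum_j m j x ^+ 2 <= q x.
Hypothesis D_le_q : forall x, D x ^+ 2 <= q x.
Hypothesis q_gt0 : forall x, 0 < q x.

Local Notation mu := (@lebesgue_measure R).

(** Beyond this radius [D > 2 * T], so [q > 4 * T ^+ 2] and the cutoff [P] is zero. The value does
    not depend on the net. *)
Definition box_radius : R := a + 2 * T.
Let B := box_radius.

Let T0 : 0 < T. Proof. exact: lt_le_trans s0 sT. Qed.
Let B0 : 0 <= B. Proof. by rewrite addr_ge0 // mulr_ge0 // ltW. Qed.

Let T4 : 0 < 4 * T ^+ 2. Proof. by rewrite mulr_gt0 // exprn_gt0. Qed.

Let q_far x : B < `|x| -> 4 * T ^+ 2 < q x.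
Proof.
move=> Bx; have TD : 2 * T < D x.
  by have := lt_le_trans Bx (Da x); rewrite ltrD2l.
apply: lt_le_trans (D_le_q x).
have -> : 4 * T ^+ 2 = (2 * T) ^+ 2 by ring.
by rewrite ltr_pXn2r // nnegrE // mulr_ge0 // ltW.
Qed.

(** Up to the cutoff [P ^+ 2], the field [X] is the gradient of sqrt(q + s^2). Adding s^2 keeps
    [S >= s], which bounds the divergence from above even near the set; where sqrt q >= s it changes
    the field by a bounded factor only. *)
Let P x : R := pp (1 - q x / (4 * T ^+ 2)).
Let S x : R := Num.sqrt (q x + s ^+ 2).
Let X j x : R := P x ^+ 2 * (m j x / S x).
Let dX i j x : R := P x ^+ 2 * (h i j x / S x - m j x * m i x / S x ^+ 3)
  - P x * m i x / T ^+ 2 * (m j x / S x).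

Let cP : continuous P.
Proof.
apply: (@continuous_compose _ _ (@pp R)); first exact: pp_continuous.
by apply: continuous_sub; [exact: continuous_const|apply: continuous_mul => //; exact: continuous_const].
Qed.

Let qs_gt0 x : 0 < q x + s ^+ 2.
Proof. by rewrite addr_gt0 // exprn_gt0. Qed.

Let S_gt0 x : 0 < S x. Proof. by rewrite sqrtr_gt0. Qed.

Let S2 x : S x ^+ 2 = q x + s ^+ 2.
Proof. by rewrite sqr_sqrtr // ltW. Qed.

Let s_le_S x : s <= S x.
Proof.
by apply: le_of_sqr; [exact: ltW|rewrite S2 lerDr ltW].
Qed.

Let cS : continuous S.
Proof.
apply: (@continuous_compose _ _ (@Num.sqrt R)); first exact: sqrt_continuous.
by apply: continuous_add => //; exact: continuous_const.
Qed.

Let cSV : continuous (fun x => (S x)^-1).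
Proof. by apply: continuous_inv => // x; rewrite gt_eqF. Qed.

Let P_ge0 x : 0 <= P x. Proof. exact: pp_ge0. Qed.

Let P_le1 x : P x <= 1.
Proof.
by rewrite /P /pp ge_max ler01 gerBl divr_ge0 // ltW.
Qed.

Let P_far x : B < `|x| -> P x = 0.
Proof.
move=> /q_far h4; rewrite /P /pp max_l // subr_le0 ler_pdivlMr // mul1r.
exact: ltW.
Qed.

Let deriv_P2 i x : is_derive x (delta_mx 0 i) (fun x => P x ^+ 2) (- (P x * m i x / T ^+ 2)).
Proof.
have D1 := is_derive_add (is_derive_const 1 x (delta_mx 0 i)) (is_derive_scale (- (4 * T ^+ 2)^-1) (deriv_q i x)).
have := is_derive_comp D1 (pp_sqr_deriv _).
have -> : (fun v : R => pp v ^+ 2) \o (fun x => 1 + - (4 * T ^+ 2)^-1 * q x) = (fun x => P x ^+ 2).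
  by apply/funext => z /=; rewrite /P mulNr mulrC.
congr is_derive; rewrite /P.
have -> : 1 - q x / (4 * T ^+ 2) = 1 + - (4 * T ^+ 2)^-1 * q x by rewrite mulNr mulrC.
by field; rewrite gt_eqF.
Qed.

Let deriv_SV i x : is_derive x (delta_mx 0 i) (fun x => (S x)^-1) (- (m i x / S x ^+ 3)).
Proof.
have D1 := is_derive_add (deriv_q i x) (is_derive_const (s ^+ 2) x (delta_mx 0 i)).
have D2 := is_derive_comp D1 (is_derive1_sqrt (qs_gt0 x)).
have Sn0 : S x != 0 by rewrite gt_eqF.
have := is_derive_inv Sn0 D2; congr is_derive; rewrite -/(S x).
by field.
Qed.

Let deriv_X i j x : is_derive x (delta_mx 0 i) (X j) (dX i j x).
Proof.
have := is_derive_mul (deriv_P2 i x) (is_derive_mul (deriv_m i j x) (deriv_SV i x)).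
by congr is_derive; rewrite /dX; field; rewrite !gt_eqF.
Qed.

Let cX' j : continuous (X j).
Proof. by apply: continuous_mul; [exact: continuous_expn|exact: continuous_mul]. Qed.

Let cdX i j : continuous (dX i j).
Proof.
have cS3 : continuous (fun x => (S x ^+ 3)^-1).
  by apply: continuous_inv => [x|]; [rewrite expf_neq0 // gt_eqF|exact: continuous_expn].
apply: continuous_sub.
- apply: continuous_mul; first exact: continuous_expn.
  apply: continuous_sub; first exact: continuous_mul.
  by apply: continuous_mul => //; exact: continuous_mul.
- apply: continuous_mul; last exact: continuous_mul.
  by apply: continuous_mul; [exact: continuous_mul|exact: continuous_const].
Qed.

Let pdX i j : pd i (X j) = dX i j.
Proof. by apply/funext => x; rewrite /pd; case: (deriv_X i j x). Qed.

Let X_far j : vanish B (X j).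
Proof. by move=> x /P_far Px; rewrite /X Px expr0n mul0r. Qed.

Let dX_far i j : vanish B (dX i j).
Proof. by rewrite -pdX; exact: pd_vanish. Qed.

Definition div_field x := \sum_j dX j j x.

Lemma div_field_pd x : div_field x = \sum_j pd j (X j) x.
Proof. by apply: eq_bigr => j _; rewrite pdX. Qed.

Lemma div_field_continuous : continuous div_field.
Proof. exact: continuous_sum. Qed.

Lemma div_field_vanish : vanish B div_field.
Proof. by move=> x Bx; rewrite /div_field big1 // => j _; exact: dX_far. Qed.

Let bbs_div : bbs d (fun t => div_field (rowS d t)).
Proof. exact: bbs_vanish div_field_continuous div_field_vanish. Qed.

(** Only the trace of [h], divided by [S >= s], can contribute positively: both the cutoff and
    [1 / S] decrease in the direction [m], so their derivatives enter with a favourable sign. *)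
Lemma div_field_le x : div_field x <= d%:R / s.
Proof.
apply: (@le_trans _ _ (\sum_(j < d) s^-1)); last first.
  by rewrite sumr_const card_ord mulr_natl.
apply: ler_sum => j _; rewrite /dX.
have h1 : 0 <= P x * m j x / T ^+ 2 * (m j x / S x).
  have -> : P x * m j x / T ^+ 2 * (m j x / S x) = P x / T ^+ 2 / S x * m j x ^+ 2 by ring.
  by rewrite mulr_ge0 ?sqr_ge0 // !mulr_ge0 ?invr_ge0 ?sqr_ge0 // ltW.
rewrite lerBlDr; apply: le_trans (_ : s^-1 <= _); last by rewrite lerDl.
have h2 : h j j x / S x - m j x * m j x / S x ^+ 3 <= s^-1.
  rewrite lerBlDr; apply: le_trans (_ : s^-1 <= _).
    apply: le_trans (_ : 1 / S x <= _); first by rewrite ler_pM2r ?invr_gt0.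
    by rewrite mul1r lef_pV2 ?posrE.
  by rewrite lerDl -expr2 divr_ge0 ?sqr_ge0 // exprn_ge0 // ltW.
have P21 : P x ^+ 2 <= 1 by rewrite exprn_ile1.
have sV : 0 <= s^-1 by rewrite invr_ge0 ltW.
apply: le_trans (_ : P x ^+ 2 * s^-1 <= _); first by rewrite ler_wpM2l ?sqr_ge0.
by rewrite -[leRHS]mul1r ler_wpM2r.
Qed.

Lemma J_div_field : Jv div_field = 0.
Proof.
have bX i : bbs d (fun t => pd i (X i) (rowS d t)).
  by rewrite pdX; exact: (bbs_vanish B0 (@cdX i i) (@dX_far i i)).
have [_] := J_sum bX.
rewrite [X in _ = X]big1 => [E|i _]; last first.
  apply: (Jv_pd_eq0 B0) => //; first by rewrite pdX.
  by move=> x; case: (deriv_X i i x).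
rewrite -[RHS]E; apply: eq_J => t _; exact: div_field_pd.
Qed.

(** The function |div X| + div X is at most 2 d / s and vanishes off a cube of side 2B; this is the
    resulting bound on its integral. *)
Definition div_bound := 2 * (d%:R / s) * (2 * B) ^+ d.

(* The divergence is bounded above and has total integral zero, which bounds
   its L1 norm independently of how close [q] is to [D ^+ 2]. *)
Lemma J_norm_div_field : Jv (fun x => `|div_field x|) <= div_bound.
Proof.
have ds : 0 <= d%:R / s by rewrite divr_ge0 // ltW.
have bn := bbs_norm bbs_div.
have -> : Jv (fun x => `|div_field x|) = Jv (fun x => `|div_field x| + div_field x).
  by rewrite JvD // J_div_field addr0.
apply: le_trans (ler_norm _) _; apply: J_bound => //; first by rewrite mulr_ge0.
- exact: bbsD.
- move=> t _; have := div_field_le (rowS d t).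
  set z := div_field _ => hz; case: (lerP 0 z) => z0.
    by rewrite (ger0_norm z0) ger0_norm ?addr_ge0 // mulr_natl mulr2n lerD.
  by rewrite (ltr0_norm z0) addNr normr0 mulr_ge0.
- move=> t td tB; rewrite div_field_vanish ?normr0 ?addr0 //.
  by rewrite ltNge -(box_norm B0 td).
Qed.

Lemma field_le1 x : enorm (\row_j X j x) <= 1.
Proof.
rewrite -(ler_pXn2r (ltn0Sn 1)) ?nnegrE ?enorm_ge0 // sqr_enorm expr1n /sqn.
have -> : \sum_i (\row_j X j x) ord0 i ^+ 2 = (P x ^+ 2 / S x) ^+ 2 * \sum_i m i x ^+ 2.
  rewrite mulr_sumr; apply: eq_bigr => i _; rewrite mxE /X; ring.
rewrite exprMn exprVn S2.
have P4 : (P x ^+ 2) ^+ 2 <= 1 by rewrite exprn_ile1 ?sqr_ge0 // exprn_ile1.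
rewrite mulrAC ler_pdivrMr // mul1r.
apply: le_trans (_ : \sum_i m i x ^+ 2 <= _).
  by rewrite -[leRHS]mul1r ler_wpM2r // sumr_ge0 // => i _; exact: sqr_ge0.
by apply: le_trans (m_le_q x) _; rewrite lerDl sqr_ge0.
Qed.

Definition flux (t : R) : R := Jv (fun x => (D x <= t)%R%:R * div_field x).

Let bbs_flux t : bbs d (fun v => (D (rowS d v) <= t)%R%:R * div_field (rowS d v)).
Proof.
apply: (@bbsMl _ _ _ _ 1) => //.
- apply: (@mseq_comp _ _ (fun y => (y <= t)%R%:R) (fun v => D (rowS d v))).
    exact: measurable_le_nat.
  exact: mseq_row.
- by move=> v _; rewrite ger0_norm // lern1 leq_b1.
Qed.

(** [X] is one competitor in the supremum defining the perimeter. This inequality is the only link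
    between the energy and the perimeter. *)
Lemma flux_le_perimeter t : ((flux t)%:E <= perimeter (nbhd_closed A t))%E.
Proof.
apply: ereal_sup_ubound; exists X; split.
- move=> j; split; first exact: cX'.
  split; first by move=> i x; case: (deriv_X i j x).
  by move=> i; rewrite pdX.
- apply: bounded_closed_compact; last exact: closed_closure.
  have cl : closed [set x : 'rV[R]_d | `|x| <= B].
    rewrite -[X in closed X]/((fun x : 'rV[R]_d => `|x|) @^-1` [set y | y <= B]).
    by apply: closed_comp => [x _|]; [exact: norm_continuous|exact: closed_le].
  exists B; split; first exact: num_real.
  move=> M BM x /= clx; apply: le_trans (ltW BM).
  apply: cl; apply: closureS clx => z [j /= Xz]; rewrite leNgt; apply: contra Xz.
  by move=> /X_far ->.
- exact: field_le1.
- rewrite -(intRdE (bbs_flux t)); congr intRd; apply/funext => x; congr EFin.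
  rewrite -div_field_pd; congr (_ * _); rewrite indicE; congr (_%:R); congr nat_of_bool.
  by apply/idP/idP; rewrite inE => /DA.
Qed.

Lemma flux_bound t : `|flux t| <= div_bound.
Proof.
apply: le_trans (ler_norm_J (bbs_flux t)) _; apply: le_trans J_norm_div_field.
apply: le_J; [exact/bbs_norm/bbs_flux|exact: bbs_norm|].
move=> v _; rewrite normrM -[leRHS]mul1r ler_wpM2r //.
by rewrite ger0_norm // lern1 leq_b1.
Qed.

(** Layer-cake formula: for fixed [x], the integral of [w] over the levels [t >= D x] is
    [tail w (D x)]. Measurability of the integrand in [t] comes from the same function of d + 1
    variables. *)
Lemma flux_integral (w : R -> R) (M K : R) : measurable_fun setT w ->
  (forall t, `|w t| <= M) -> (forall t, K < `|t| -> w t = 0) ->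
  measurable_fun setT (fun t => w t * flux t) /\
  \int[mu]_t (w t * flux t) = Jv (fun x => tail w (D x) * div_field x).
Proof.
move=> mw wM wK.
pose I (v : seq R) : R := (D (rowS d (behead v)) <= head 0 v)%R%:R.
have mI : mseq d.+1 I.
  have -> : I = (fun v => (fun y => (y <= 0)%R%:R)
      (D (rowS d (behead v)) + (-1) * head 0 v)).
    by apply/funext => v; rewrite /I mulN1r subr_le0.
  apply: (@mseq_comp R d.+1 (fun y => (y <= 0)%R%:R)
    (fun v => D (rowS d (behead v)) + (-1) * head 0 v)).
    exact: measurable_le_nat.
  apply: mseqD; first by apply: (@mseq_behead R d (fun v => D (rowS d v))); exact: mseq_row.
  by apply: mseqM; [exact: mseq_cst|exact: mseq_head].
have I1 v : size v = d.+1 -> `|I v| <= 1.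
  by move=> _; rewrite ger0_norm // lern1 leq_b1.
have bF := bbs_tensor mw wM wK mI I1 bbs_div.
set F := (fun v => _) in bF.
have FE t : J d (fun v => F (t :: v)) = w t * flux t.
  by rewrite /F /= (JZ (w t) (bbs_flux t)).
split; first by have := measurable_J bF; under eq_fun do rewrite FE.
transitivity (\int[mu]_t J d (fun v => F (t :: v))).
  by apply: eq_Rintegral => t _; rewrite FE.
rewrite -J_cons // J_Fubini //.
apply: eq_J => v dv; rewrite /F /I /= tail_indic.
transitivity (\int[mu]_t (w t * (D (rowS d v) <= t)%R%:R * div_field (rowS d v))).
  by apply: eq_Rintegral => t _; exact: mulrA.
rewrite RintegralZr //.
  congr (_ * _); apply: eq_Rintegral => t _.
  by case: ifP => _; rewrite ?mulr1 ?mulr0.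
apply: (@bounded_itv_integrable R (fun t => w t * (D (rowS d v) <= t)%R%:R) M K).
- apply: measurable_funM => //.
  have -> : (fun t => (D (rowS d v) <= t)%R%:R) =
      (fun y => (y <= 0)%R%:R : R) \o (fun t => D (rowS d v) - t).
    by apply/funext => t /=; rewrite subr_le0.
  by apply: measurableT_comp; [exact: measurable_le_nat|exact: measurable_funB].
- move=> t; rewrite normrM -[leRHS]mulr1 ler_pM //.
  by rewrite ger0_norm // lern1 leq_b1.
- by move=> t /wK ->; rewrite mul0r.
Qed.

Let r x : R := Num.sqrt (q x).

Let r_gt0 x : 0 < r x. Proof. by rewrite sqrtr_gt0. Qed.

Let r2 x : r x ^+ 2 = q x. Proof. by rewrite sqr_sqrtr // ltW. Qed.

Let D_le_r x : D x <= r x.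
Proof. by apply: le_of_sqr; [exact: ltW|rewrite r2]. Qed.

Let cr : continuous r.
Proof. by apply: (@continuous_compose _ _ (@Num.sqrt R)) => //; exact: sqrt_continuous. Qed.

Let crV : continuous (fun x => (r x)^-1).
Proof. by apply: continuous_inv => // x; rewrite gt_eqF. Qed.

Let deriv_r i x : is_derive x (delta_mx 0 i) r (m i x / r x).
Proof.
have := is_derive_comp (deriv_q i x) (is_derive1_sqrt (q_gt0 x)).
by congr is_derive; rewrite -/(r x); field; rewrite gt_eqF.
Qed.

Let r_far x : B < `|x| -> T <= r x.
Proof.
move=> /q_far h4; apply: le_of_sqr; first exact: ltW.
by rewrite r2; apply/ltW/(le_lt_trans _ h4); rewrite ler_peMl ?sqr_ge0 // ler1n.
Qed.

Variables (k : R -> R) (M : R).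
Hypotheses (ck : continuous k) (k_ge0 : forall t, 0 <= k t) (kM : forall t, k t <= M).
Hypothesis ksupp : forall t, k t != 0 -> s <= t <= T.

Let mk : measurable_fun setT k.
Proof. exact: continuous_measurable_fun. Qed.

Let k_out t : T < `|t| -> k t = 0.
Proof.
move=> Tt; apply/eqP; apply: contraTT Tt => /ksupp/andP[st tT].
by rewrite -leNgt ger0_norm // (le_trans _ st) // ltW.
Qed.

(** The support condition allows [t = T]; there continuity decides, since a nonzero value at [T]
    would persist beyond [T]. The endpoint is needed because [r_far] gives only [T <= r x]. *)
Let k_hi t : T <= t -> k t = 0.
Proof.
rewrite le_eqVlt => /orP[/eqP <-|Tt]; last first.
  by apply: k_out; exact: lt_le_trans (ler_norm _).
apply/eqP; rewrite -[_ == 0]negbK; apply/negP => kT.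
have : \forall x \near T, k x != 0.
  have oU : open [set x | k x != 0].
    rewrite -[X in open X]/(k @^-1` [set y | y != 0]).
    by apply: open_comp => [x _|]; [exact: ck|exact: open_neq].
  exact: (open_nbhs_nbhs (conj oU kT)).
move=> /nbhs_ballP[e /= e0 eT].
have /ksupp : k (T + e / 2) != 0.
  by apply: eT; rewrite /ball /= opprD addNKr normrN gtr0_norm ?divr_gt0 //; lra.
by move=> /andP[_]; rewrite gerDl leNgt divr_gt0.
Qed.

Let kM' t : `|k t| <= M. Proof. by rewrite ger0_norm. Qed.

Let M_ge0 : 0 <= M. Proof. exact: le_trans (k_ge0 0) (kM 0). Qed.

Let k2 t := k t ^+ 2.

Let ck2 : continuous k2. Proof. exact: continuous_expn. Qed.

Let mk2 : measurable_fun setT k2.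
Proof. exact: continuous_measurable_fun. Qed.

Let k2M t : `|k2 t| <= M ^+ 2.
Proof. by rewrite /k2 normrX ler_pXn2r // nnegrE. Qed.

Let k2_out t : T < `|t| -> k2 t = 0.
Proof. by move=> /k_out; rewrite /k2 => ->; rewrite expr0n. Qed.

Let deriv_tail (t : R) : is_derive t 1 (tail k) (- k t).
Proof. by apply: (tail_deriv mk kM' k_out); exact: ck. Qed.

Let deriv_tail2 (t : R) : is_derive t 1 (tail k2) (- k2 t).
Proof. by apply: (tail_deriv mk2 k2M k2_out); exact: ck2. Qed.

Definition potential x := tail k (Num.sqrt (q x)).
Definition potential_grad i x := - k (Num.sqrt (q x)) * (m i x / Num.sqrt (q x)).

Lemma potential_continuous : continuous potential.
Proof.
apply: (@continuous_compose _ _ (tail k) r) => // t; apply: differentiable_continuous.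
by apply/derivable1_diffP; case: (deriv_tail t).
Qed.

Lemma potential_grad_continuous i : continuous (potential_grad i).
Proof.
apply: continuous_mul; last exact: continuous_mul.
by apply: continuous_opp; exact: (@continuous_compose _ _ k r ck cr).
Qed.

Lemma potential_deriv i x :
  is_derive x (delta_mx 0 i) potential (potential_grad i x).
Proof. by have := is_derive_comp (deriv_r i x) (deriv_tail _). Qed.

Lemma potential_vanish : vanish B potential.
Proof.
move=> x /r_far Tr; apply: tail_eq0 => t rt; apply: k_hi; exact: le_trans rt.
Qed.

Lemma potential_ge0 x : 0 <= potential x.
Proof. exact: tail_ge0. Qed.

(** On the set the smoothed distance is small but not zero. As [tail k] is [M]-Lipschitz and takes
    its full value at 0, this costs at most [M * e]. *)
Lemma potential_ge x e : Num.sqrt (q x) <= e -> \int[mu]_t k t - M * e <= potential x.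
Proof.
move=> re; have e0 : 0 <= e by apply: le_trans re; exact: sqrtr_ge0.
have k0 t : t < 0 -> k t = 0.
  move=> t0; apply/eqP; apply: contraTT t0 => /ksupp/andP[st _].
  by rewrite -leNgt (le_trans _ st) // ltW.
have := tail_lipschitz mk kM' k_out 0 (r x) ck.
rewrite (tail_full k0) sub0r normrN (ger0_norm (ltW (r_gt0 x))) => h1.
rewrite lerBlDr -lerBlDl; apply: le_trans (ler_norm _) _; apply: le_trans h1 _.
by rewrite ler_wpM2l.
Qed.

(** With Y = [tail k2] of sqrt q, the divergence of Y X has integral zero, so the integral of Q = -
    DY . X, which dominates a quarter of the energy, equals that of Y div X. Replacing sqrt q by [D]
    inside the [M ^+ 2]-Lipschitz tail costs [M ^+ 2 * e] times the L1 norm of div X, and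
    [flux_integral] evaluates the rest. *)
Lemma energy_le e : (forall x, Num.sqrt (q x) <= D x + e) ->
  Jv (fun x => \sum_i potential_grad i x ^+ 2) <=
  4 * (\int[mu]_t (k t ^+ 2 * flux t) + M ^+ 2 * e * div_bound).
Proof.
move=> re.
have e0 : 0 <= e.
  have := re 0; have := D_le_r 0; rewrite -/(r 0); lra.
pose Y x := tail k2 (r x).
have ct : continuous (tail k2).
  move=> t; apply: differentiable_continuous.
  by apply/derivable1_diffP; case: (deriv_tail2 t).
have cY : continuous Y by exact: continuous_compose.
have YD x : `|Y x - tail k2 (D x)| <= M ^+ 2 * e.
  apply: le_trans (tail_lipschitz mk2 k2M k2_out _ _ ck2) _.
  rewrite ler_wpM2l ?sqr_ge0 // ger0_norm ?subr_ge0 //.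
  by rewrite lerBlDl; exact: re.
have dY i x : is_derive x (delta_mx 0 i) Y (- k2 (r x) * (m i x / r x)).
  exact: is_derive_comp (deriv_r i x) (deriv_tail2 _).
pose G i x := Y x * X i x.
pose dG i x := Y x * dX i i x - k2 (r x) * (m i x / r x) * X i x.
have deriv_G i x : is_derive x (delta_mx 0 i) (G i) (dG i x).
  have := is_derive_mul (dY i x) (deriv_X i i x); congr is_derive; rewrite /dG; ring.
have pdG i : pd i (G i) = dG i.
  by apply/funext => x; rewrite /pd; case: (deriv_G i x).
have ck2r : continuous (fun x => k2 (r x)) by exact: continuous_compose.
have cdG i : continuous (dG i).
  apply: continuous_sub; first exact: continuous_mul.
  apply: continuous_mul => //; apply: continuous_mul => //; exact: continuous_mul.
have vG i : vanish B (G i) by move=> x /X_far h0; rewrite /G h0 mulr0.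
have bG i : bbs d (fun t => dG i (rowS d t)).
  apply: (bbs_vanish B0) => //; rewrite -pdG; exact: pd_vanish.
have JG i : Jv (dG i) = 0.
  rewrite -pdG; apply: (Jv_pd_eq0 B0) => //; first by rewrite pdG.
pose Q x := k2 (r x) * (P x ^+ 2 / (S x * r x)) * \sum_i m i x ^+ 2.
have sumG x : \sum_i dG i x = Y x * div_field x - Q x.
  rewrite /dG sumrB -mulr_sumr; congr (_ - _).
  rewrite /Q mulr_sumr; apply: eq_bigr => i _; rewrite /X; field.
  by rewrite !gt_eqF.
have bQ : bbs d (fun t => Q (rowS d t)).
  apply: (bbs_vanish (f := Q) B0); last first.
    by move=> x /P_far h0; rewrite /Q h0 expr0n !(mul0r, mulr0).
  apply: continuous_mul; last by apply: continuous_sum => i; exact: continuous_expn.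
  apply: continuous_mul => //; apply: continuous_mul; first exact: continuous_expn.
  by apply: continuous_inv; [move=> x; rewrite mulf_neq0 // gt_eqF|exact: continuous_mul].
have bYd : bbs d (fun t => Y (rowS d t) * div_field (rowS d t)).
  apply: (bbs_vanish (f := fun x => Y x * div_field x) B0).
    by apply: continuous_mul => //; exact: div_field_continuous.
  by move=> x /div_field_vanish ->; rewrite mulr0.
have bDd : bbs d (fun t => tail k2 (D (rowS d t)) * div_field (rowS d t)).
  apply: (bbs_vanish (f := fun x => tail k2 (D x) * div_field x) B0).
    apply: continuous_mul; last exact: div_field_continuous.
    exact: (@continuous_compose _ _ (tail k2) D).
  by move=> x /div_field_vanish ->; rewrite mulr0.
have JQ : Jv Q = Jv (fun x => Y x * div_field x).
  have [_] := J_sum bG; rewrite big1 => [E|i _]; last exact: JG.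
  apply/eqP; rewrite eq_sym -subr_eq0 -mulN1r -(JZ _ bQ) -JD //; last exact: bbsZ.
  apply/eqP; rewrite -[RHS]E; apply: eq_J => t _.
  by rewrite mulN1r -sumG.
have bg : bbs d (fun t => \sum_i potential_grad i (rowS d t) ^+ 2).
  apply: (bbs_vanish (f := fun x => \sum_i potential_grad i x ^+ 2) B0).
    by apply: continuous_sum => i; apply: continuous_expn; exact: potential_grad_continuous.
  move=> x /r_far Tr; rewrite big1 // => i _.
  by rewrite /potential_grad k_hi // oppr0 mul0r expr0n.
(* Where [k (r x)] is nonzero, s <= r <= T. Then S <= 2 r, and q <= T^2 gives P >= 3/4, so P^2 >=
   1/2; together P^2 / (S r) >= 1 / (4 r^2), whence the factor 4. *)
apply: (@le_trans _ _ (4 * Jv Q)).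
  rewrite -(JZ 4 bQ); apply: le_J => //; first exact: bbsZ.
  move=> t _; set x := rowS d t.
  have -> : \sum_i potential_grad i x ^+ 2 = k2 (r x) * (q x)^-1 * \sum_i m i x ^+ 2.
    rewrite mulr_sumr; apply: eq_bigr => i _; rewrite /potential_grad -/(r x) /k2 -r2.
    by field; rewrite gt_eqF.
  have -> : 4 * Q x = k2 (r x) * (4 * P x ^+ 2 / (S x * r x)) * \sum_i m i x ^+ 2.
    by rewrite /Q; ring.
  rewrite ler_wpM2r ?sumr_ge0 // => [i _|]; first exact: sqr_ge0.
  have [k0|kn0] := eqVneq (k (r x)) 0; first by rewrite /k2 k0 expr0n !mul0r.
  have /andP[sr rT] := ksupp kn0.
  rewrite ler_wpM2l ?sqr_ge0 //.
  have S_le : S x <= 2 * r x.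
    apply: le_of_sqr; first by rewrite mulr_ge0 // ltW.
    rewrite S2 -r2 exprMn.
    have : s ^+ 2 <= r x ^+ 2 by rewrite ler_pXn2r // nnegrE ltW.
    have := sqr_ge0 (r x); lra.
  have P_ge : 3 / 4 <= P x.
    rewrite /P /pp le_max; apply/orP; right.
    have : q x / (4 * T ^+ 2) <= 4^-1.
      rewrite ler_pdivrMr // mulrA mulVf // mul1r -r2.
      by rewrite ler_pXn2r // nnegrE ltW.
    lra.
  have P2 : 1 / 2 <= P x ^+ 2.
    apply: le_trans (_ : (3 / 4) ^+ 2 <= _); first lra.
    by rewrite ler_pXn2r // nnegrE // (le_trans _ P_ge).
  rewrite -r2 expr2 invfM ler_pdivlMr ?mulr_gt0 //.
  have -> : (r x)^-1 / r x * (S x * r x) = S x / r x by field; rewrite gt_eqF.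
  rewrite ler_pdivrMr //; apply: le_trans S_le _.
  by rewrite ler_pM2r //; lra.
rewrite ler_pM2l // JQ.
have [_ ->] := flux_integral mk2 k2M k2_out.
have bn := bbs_norm bbs_div.
apply: (@le_trans _ _ (Jv (fun x => tail k2 (D x) * div_field x
    + (M ^+ 2 * e) * `|div_field x|))).
  apply: le_J => //; first by apply: bbsD => //; exact: bbsZ.
  move=> t _; set x := rowS d t; rewrite -lerBlDl -mulrBl.
  apply: le_trans (ler_norm _) _; rewrite normrM; apply: ler_wpM2r => //.
rewrite JvD //; last exact: bbsZ.
rewrite lerD2l [X in X <= _](JZ _ bn) ler_wpM2l //.
  by rewrite mulr_ge0 ?sqr_ge0.
exact: J_norm_div_field.
Qed.

End Energy.

(** * Competitors for the capacity *)

Section CapacityBound.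
Variables (R : realType) (d : nat).
Local Notation mu := (@lebesgue_measure R).

Lemma scaled_C1_in_D1 (u : 'rV[R]_d -> R) (g : 'I_d -> 'rV[R]_d -> R) (B c : R) :
  0 <= B -> vanish B u -> continuous u -> (forall i, continuous (g i)) ->
  (forall i x, is_derive x (delta_mx 0 i) u (g i x)) ->
  in_D1 (fun x => c * u x) (fun i x => c * g i x) /\
  intRd (fun x => (\sum_i (c * g i x) ^+ 2)%:E) =
    (c ^+ 2 * Jv (fun x => \sum_i g i x ^+ 2))%:E.
Proof.
move=> B0 uB cu cg ug.
have [H ->] : in_D1 (fun x => c * u x) (fun i x => c * g i x) /\
  intRd (fun x => (\sum_i (c * g i x) ^+ 2)%:E) =
  (Jv (fun x => \sum_i (c * g i x) ^+ 2))%:E.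
  apply: (C1_in_D1 B0).
  - by move=> x Bx; rewrite uB // mulr0.
  - by apply: continuous_mul => //; exact: continuous_const.
  - by move=> i; apply: continuous_mul => //; exact: continuous_const.
split=> //; congr EFin.
have gB i : vanish B (g i).
  have <- : pd i u = g i by apply/funext => x; rewrite /pd; case: (ug i x).
  exact: pd_vanish.
have bg : bbs d (fun t => \sum_i g i (rowS d t) ^+ 2).
  apply: (bbs_vanish (f := fun x => \sum_i g i x ^+ 2) B0).
    by apply: continuous_sum => i; exact: continuous_expn.
  by move=> x Bx; rewrite big1 // => i _; rewrite gB // expr0n.
rewrite -(JZ _ bg); apply: eq_J => t _; rewrite mulr_sumr.
by apply: eq_bigr => i _; rewrite exprMn.
Qed.

(* The bound [C] on the fluxes [p t] depends on [A], [s] and [T] only, so that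
   [k] may be chosen after it. *)
Lemma radial_competitors (A : set 'rV[R]_d) (s T : R) :
  compact A -> A !=set0 -> 0 < s -> s <= T ->
  exists2 C, 0 <= C & forall (k : R -> R) (M : R), continuous k ->
    (forall t, 0 <= k t) -> (forall t, k t <= M) ->
    (forall t, k t != 0 -> s <= t <= T) -> forall e, 0 < e ->
  exists (u : 'rV[R]_d -> R) (g : 'I_d -> 'rV[R]_d -> R) (B : R) (p : R -> R),
  [/\ 0 <= B, vanish B u, continuous u, forall i, continuous (g i) &
      forall i x, is_derive x (delta_mx 0 i) u (g i x)] /\
  [/\ forall x, 0 <= u x, forall x, A x -> \int[mu]_t k t - M * e <= u x,
      forall t, ((p t)%:E <= perimeter (nbhd_closed A t))%E /\ `|p t| <= C,
      measurable_fun setT (fun t => k t ^+ 2 * p t) &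
      Jv (fun x => \sum_i g i x ^+ 2) <=
        4 * (\int[mu]_t (k t ^+ 2 * p t) + M ^+ 2 * e * C)].
Proof.
move=> cA A0 s0 sT.
have [a a0 Aa] := compact_norm_bound cA.
have [D [c_dist Datt Dle]] := dist_exists cA A0.
have D_ge0 x : 0 <= D x by have [b _ ->] := Datt x; exact: enorm_ge0.
have DA t x : nbhd_closed A t x <-> D x <= t.
  split=> [[b Ab]|]; first exact: le_trans (Dle x b Ab).
  by have [b Ab ->] := Datt x => h; exists b.
have Da x : `|x| <= a + D x.
  have [b Ab ->] := Datt x; rewrite -{1}(subrK b x) addrC.
  apply: le_trans (ler_normD _ _) _; apply: lerD; first exact: Aa.
  exact: norm_le_enorm.
exists (div_bound d a s T).
  rewrite /div_bound /box_radius mulr_ge0 // ?mulr_ge0 ?invr_ge0 ?(ltW s0) //.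
  by rewrite exprn_ge0 // mulr_ge0 // addr_ge0 // mulr_ge0 // (le_trans _ sT) // ltW.
move=> k M ck k0 kM ksupp e e0.
have e2 : 0 < e / 2 by rewrite divr_gt0.
have [N [y [Ay net]]] := finite_net cA A0 e2.
(* Chosen so that the shift of the soft minimum equals (e/2)^2. *)
pose b := 4 * N.+1%:R / (e / 2) ^+ 2.
have b0 : 0 < b by rewrite divr_gt0 ?mulr_gt0 ?exprn_gt0.
have bE : 4 * N.+1%:R / b = (e / 2) ^+ 2.
  by rewrite /b invfM invrK mulrA divff ?mul1r // mulf_neq0.
have [q [m [h [[cm ch dq dm h1] [cq mq qle qge]]]]] := soft_min y b0.
have Dq2 x : D x ^+ 2 + 2 * N.+1%:R / b <= q x.
  apply: qge => j; rewrite -sqr_enorm ler_pXn2r ?nnegrE ?enorm_ge0 //.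
  exact: Dle.
have Nb : 0 < 2 * N.+1%:R / b by rewrite divr_gt0 // mulr_gt0.
have Dq x : D x ^+ 2 <= q x.
  by apply: le_trans (Dq2 x); rewrite lerDl ltW.
have q0 x : 0 < q x.
  by apply: lt_le_trans (Dq2 x); rewrite ltr_wpDl ?sqr_ge0.
(* One half of [e] comes from the net, the other from the smoothing: (D + e/2)^2 + (e/2)^2 <= (D +
   e)^2. *)
have rD x : Num.sqrt (q x) <= D x + e.
  apply: le_of_sqr; first by rewrite addr_ge0 // ltW.
  rewrite sqr_sqrtr; last exact: ltW.
  have [c Ac Dc] := Datt x; have [j yj] := net c Ac.
  apply: le_trans (qle j x) _; rewrite bE -sqr_enorm.
  have xy : enorm (x - y j) <= D x + e / 2.
    have -> : x - y j = (x - c) + (c - y j) by rewrite addrA subrK.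
    by apply: le_trans (enormD _ _) _; rewrite -Dc lerD2l ltW.
  apply: le_trans (_ : (D x + e / 2) ^+ 2 + (e / 2) ^+ 2 <= _).
    by rewrite lerD2r ler_pXn2r ?nnegrE ?enorm_ge0 // addr_ge0 // ltW.
  have De : 0 <= D x * e by rewrite mulr_ge0 // ltW.
  have := sqr_ge0 e.
  have -> : (D x + e / 2) ^+ 2 + (e / 2) ^+ 2 = D x ^+ 2 + D x * e + e ^+ 2 / 2.
    by field.
  have -> : (D x + e) ^+ 2 = D x ^+ 2 + 2 * (D x * e) + e ^+ 2 by ring.
  lra.
exists (potential q k), (potential_grad q m k), (box_radius a T),
  (flux D s T q m h).
split; split.
- by rewrite /box_radius addr_ge0 // mulr_ge0 // (le_trans _ sT) // ltW.
- exact: (potential_vanish s0 sT D_ge0 Da Dq q0 ck ksupp).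
- exact: (potential_continuous s0 cq ck k0 kM ksupp).
- by move=> i; apply: potential_grad_continuous.
- exact: (potential_deriv s0 dq q0 ck k0 kM ksupp).
- by move=> x; exact: potential_ge0.
- move=> x Ax; apply: (potential_ge s0 q0 ck k0 kM ksupp).
  apply: le_trans (rD x) _; rewrite -[leRHS]add0r lerD2r.
  by apply: le_trans (Dle x x Ax) _; rewrite subrr /enorm big1 ?sqrtr0 // => i _; rewrite mxE expr0n.
- move=> t; split.
    exact: (flux_le_perimeter a0 s0 sT c_dist D_ge0 DA Da cq cm ch dq dm mq Dq q0).
  exact: (flux_bound a0 s0 sT c_dist D_ge0 Da cq cm ch dq dm h1 Dq q0).
- have k2c : continuous (fun t => k t ^+ 2) by exact: continuous_expn.
  have M0 : 0 <= M by exact: le_trans (k0 0) (kM 0).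
  apply: (@flux_integral _ _ _ _ _ _ a0 s0 sT c_dist D_ge0 Da _ _ _ cq cm ch dq dm Dq q0 _ (M ^+ 2) T _ _ _).1.
  + exact: continuous_measurable_fun.
  + by move=> t; rewrite normrX ler_pXn2r ?nnegrE // ger0_norm.
  + move=> t Tt; apply/eqP; rewrite sqrf_eq0; apply: contraTT Tt => /ksupp/andP[st tT].
    by rewrite -leNgt ger0_norm // (le_trans _ st) // ltW.
- by apply: (energy_le a0 s0 sT c_dist D_ge0 Da cq cm ch dq dm h1 Dq q0 ck k0 kM ksupp).
Qed.
End CapacityBound.

(** * Continuous approximation in L1 under pointwise bounds and support constraints *)

Section ContinuousApproximation.
Variable R : realType.
Local Notation mu := (@lebesgue_measure R).

(** The truncation min(N, max(0, y)) for N >= 0, composed from [pp] to inherit its continuity. *)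
Definition clamp (N y : R) : R := N - pp (N - pp y).

Lemma clamp_continuous N : continuous (clamp N).
Proof.
apply: continuous_sub; first exact: continuous_const.
apply: (@continuous_compose _ _ (@pp R)); first exact: pp_continuous.
by apply: continuous_sub; [exact: continuous_const|exact: pp_continuous].
Qed.

Lemma clamp_ge0 (N y : R) : 0 <= N -> 0 <= clamp N y.
Proof.
move=> *; rewrite /clamp /pp;
  case: (leP 0 y) => ?; [case: (leP 0 (N - y)) => ?|case: (leP 0 (N - 0)) => ?]; lra.
Qed.

Lemma clamp_le (N y : R) : clamp N y <= N.
Proof. by rewrite /clamp gerBl /pp le_max lexx. Qed.

Lemma clamp_eq0 (N y : R) : 0 <= N -> y <= 0 -> clamp N y = 0.
Proof.
move=> *; rewrite /clamp /pp;
  case: (leP 0 y) => ?; [case: (leP 0 (N - y)) => ?|case: (leP 0 (N - 0)) => ?]; lra.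
Qed.

Lemma clamp_full (N y : R) : N <= y -> 0 <= N -> clamp N y = N.
Proof.
move=> *; rewrite /clamp /pp;
  case: (leP 0 y) => ?; [case: (leP 0 (N - y)) => ?|case: (leP 0 (N - 0)) => ?]; lra.
Qed.

Lemma clamp_dist (N x y : R) : 0 <= x <= N -> `|clamp N y - x| <= `|y - x|.
Proof.
move=> /andP[x0 xN]; rewrite /clamp /pp.
case: (leP 0 y) => ?; [case: (leP 0 (N - y)) => ?|case: (leP 0 (N - 0)) => ?];
  by case: (ger0P (y - x)) => ?; rewrite ler_norml; apply/andP; split; lra.
Qed.

(** Continuous functions are dense in L1; truncating the approximant to [0, N] does not increase its
    distance to [f], and neither does multiplication by a cutoff that is 1 on the support of [f]. *)
Lemma continuous_approx (f : R -> R) (N s T e : R) :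
  measurable_fun setT f -> (forall t, 0 <= f t <= N) ->
  (forall t, f t != 0 -> 2 * s <= t <= T) -> 0 < s -> 0 < e ->
  exists k : R -> R, [/\ continuous k, forall t, 0 <= k t <= N,
    forall t, k t != 0 -> s <= t <= T + 1 & \int[mu]_t `|k t - f t| <= e].
Proof.
move=> mf fN fsupp s0 e0.
have N0 : 0 <= N by have /andP[] := fN 0; exact: le_trans.
pose B := `|T| + 1.
pose E : set R := `[- B, B]%classic.
have mE : measurable E by exact: measurable_itv.
have fB t : B < `|t| -> f t = 0.
  move=> Bt; apply/eqP; apply: contraTT Bt => /fsupp/andP[st tT].
  have t0 : 0 <= t by lra.
  by rewrite -leNgt ger0_norm // (le_trans tT) // ler_wpDr // ler_norm.
have fbd t : `|f t| <= N by have /andP[f0 fle] := fN t; rewrite ger0_norm.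
have ifE : mu.-integrable E (EFin \o f).
  by apply: integrableS (bounded_itv_integrable mf fbd fB).
have muE : (mu E < +oo)%E.
  by rewrite /E lebesgue_measure_itv /=; case: ifPn => // _; rewrite ltry.
have [g_ [cg_ ig_ g_0]] := approximation_continuous_integrable mE muE ifE.
have [n [ng ig cg]] : exists n, [/\ (\int[mu]_(z in E) `|(f z - g_ n z)%:E| < e%:E)%E,
    mu.-integrable E (EFin \o g_ n) & continuous (g_ n)].
  have ev : \forall n \near \oo, (\int[mu]_(z in E) `|(f z - g_ n z)%:E| < e%:E)%E.
    apply: (g_0 [set y | (y < e%:E)%E]); apply: open_nbhs_nbhs.
    by split; [exact: open_ereal_lt_ereal|rewrite /= lte_fin].
  by have [n nE] := filter_ex ev; exists n.
pose g := g_ n.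
(* The two ramps live on [s, 2s] and [T, T + 1]. The first one needs room to the left of the
   support, hence [2 * s] in the hypothesis. *)
pose k t := clamp 1 ((t - s) / s) * clamp 1 (T + 1 - t) * clamp N (g t).
have ck : continuous k.
  have cid : continuous (fun t : R => t) by move=> t; exact: cvg_id.
  apply: continuous_mul; first apply: continuous_mul.
  - apply: (@continuous_compose _ _ (clamp 1)); first exact: clamp_continuous.
    by apply: continuous_mul; [apply: continuous_sub => //|]; exact: continuous_const.
  - apply: (@continuous_compose _ _ (clamp 1)); first exact: clamp_continuous.
    by apply: continuous_sub => //; exact: continuous_const.
  - by apply: (@continuous_compose _ _ (clamp N)) => //; exact: clamp_continuous.
have k0 t : 0 <= k t by rewrite !mulr_ge0 // clamp_ge0.
have kg t : k t <= clamp N (g t).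
  rewrite /k -[leRHS]mul1r ler_wpM2r ?clamp_ge0 //.
  by rewrite mulr_ile1 ?clamp_ge0 ?clamp_le.
have ksupp t : k t != 0 -> s <= t <= T + 1.
  move=> kt; apply/andP; split; rewrite leNgt; apply: contra kt => h.
    by rewrite /k clamp_eq0 ?mul0r // pmulr_lle0 ?invr_gt0 // subr_le0 ltW.
  by rewrite /k [X in _ * X * _]clamp_eq0 ?mulr0 ?mul0r // subr_le0 ltW.
have kf t : `|k t - f t| <= `|f t - g t|.
  rewrite distrC [leRHS]distrC; have [ft0|/fsupp/andP[st tT]] := eqVneq (f t) 0.
    rewrite ft0 sub0r normrN subr0 ger0_norm //; apply: le_trans (kg t) _.
    have := @clamp_dist N 0 (g t); rewrite lexx N0 !subr0 => /(_ isT).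
    by apply: le_trans; exact: ler_norm.
  rewrite distrC /k !(@clamp_full 1) ?mul1r //; first exact: clamp_dist.
    by rewrite -(subrK T t) lerBrDr; lra.
  by rewrite ler_pdivlMr // mul1r; lra.
have kB t : B < `|t| -> k t = 0.
  move=> Bt; apply/eqP; apply: contraTT Bt => /ksupp/andP[st tT].
  have t0 : 0 <= t by lra.
  by rewrite -leNgt ger0_norm // (le_trans tT) // lerD2r ler_norm.
have mk : measurable_fun setT (fun t => `|k t - f t|).
  apply: measurableT_comp => //; apply: measurable_funB => //.
  exact: continuous_measurable_fun.
exists k; split => //.
  by move=> t; rewrite k0 (le_trans (kg t)) // clamp_le.
have kfE : (fun t => `|k t - f t|) = (fun t => `|k t - f t|) \_ E.
  apply/funext => t; rewrite patchE; case: ifPn => // tE.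
  have Bt : B < `|t|.
    rewrite ltNge; apply: contra tE => tB.
    by rewrite inE /E /= in_itv /= -ler_norml.
  by rewrite kB // fB // subrr normr0.
rewrite kfE -Rintegral_mkcond /Rintegral -lee_fin.
have le1 : (\int[mu]_(t in E) (`|k t - f t|)%:E <= \int[mu]_(z in E) `|(f z - g_ n z)%:E|)%E.
  apply: ge0_le_integral => //.
  - by apply/measurable_EFinP; exact: measurable_funTS.
  - apply/measurable_EFinP; apply: measurableT_comp => //.
    apply: measurable_funTS; apply: measurable_funB => //.
    exact: continuous_measurable_fun.
  - by move=> t _; rewrite lee_fin.
rewrite fineK; first exact: le_trans le1 (ltW ng).
rewrite ge0_fin_numE; last by apply: integral_ge0 => t _; rewrite lee_fin.
by apply: le_lt_trans le1 _; apply: lt_trans ng _; rewrite ltry.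
Qed.

End ContinuousApproximation.

(** * Bounded minorants with bounded support *)

Section SimpleMinorant.
Variable R : realType.
Local Notation mu := (@lebesgue_measure R).
Import HBSimple HBNNSimple.

(** [F] is not assumed measurable: its integral is by definition a supremum over simple functions
    below it, and one of these, necessarily bounded, already has integral above [c]. *)
Lemma bounded_minorant (F : R -> \bar R) (s c : R) :
  (forall t, 0 <= F t)%E -> 0 <= s -> 
  (c%:E < \int[mu]_(t in `]s, +oo[%classic) F t)%E ->
  exists (f : R -> R) (N T : R), [/\ measurable_fun setT f,
    forall t, 0 <= f t <= N, forall t, ((f t)%:E <= F t)%E,
    forall t, f t != 0 -> s <= t <= T & c < \int[mu]_t f t].
Proof.
move=> F0 s0; rewrite ge0_integralE; last by move=> t _; exact: F0.
move=> /ereal_sup_gt[_ /= [h hF <-]]; rewrite -integralT_nnsfun => ch.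
have h0 t : 0 <= h t by exact: fun_ge0.
have mh : measurable_fun setT h by exact: measurable_funPT.
have hF' t : ((h t)%:E <= F t)%E.
  by apply: le_trans (hF t) _; rewrite patchE; case: ifPn.
have hs t : h t != 0 -> s < t.
  apply: contraNT; rewrite -leNgt => ts; rewrite eq_le h0 andbT -lee_fin.
  apply: le_trans (hF t) _; rewrite patchE ifF //.
  by apply/negP; rewrite inE /= in_itv /= andbT ltNge ts.
have [N hN] : exists N, forall t, h t <= N.
  have [M [_ hM]] := simple_bounded h; exists (M + 1) => t.
  by apply: le_trans (ler_norm _) _; apply: hM => //; rewrite ltrDl.
have [g [mg g0 gF gs [gN cg]]] : exists g : R -> R, [/\ measurable_fun setT g,
    forall t, 0 <= g t, forall t, ((g t)%:E <= F t)%E, forall t, g t != 0 -> s < t &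
    (forall t, g t <= N) /\ (c%:E < \int[mu]_t (g t)%:E)%E] by exists h.
(* The support is cut off at a large integer by monotone convergence. *)
pose E (n : nat) : set R := `]-oo, n%:R]%classic.
have mE n : measurable (E n) by exact: measurable_itv.
have UE : \bigcup_n E n = setT.
  apply/seteqP; split=> // t _; exists (Num.truncn `|t|).+1 => //.
  rewrite /E /= in_itv /=; apply: le_trans (ler_norm t) _.
  by apply: ltW; exact: Num.Theory.truncnS_gt.
have cvg : (\int[mu]_(x in E n) (g x)%:E)%E @[n --> \oo] --> (\int[mu]_x (g x)%:E)%E.
  rewrite -UE; apply: ge0_nondecreasing_set_cvg_integral => //.
  - move=> n m nm; apply/subsetPset => t; rewrite /E /= !in_itv /= => /le_trans; apply.
    by rewrite ler_nat.
  - by move=> n; apply/measurable_EFinP; exact: measurable_funTS.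
  - by move=> n t _; rewrite lee_fin.
have ev : \forall n \near \oo, (c%:E < \int[mu]_(x in E n) (g x)%:E)%E.
  by apply: (cvg [set y | (c%:E < y)%E]); apply: open_nbhs_nbhs; split => //; exact: open_ereal_gt_ereal.
have [n cn] := filter_ex ev.
have fE : (g \_ (E n) : R -> R) = fun t => g t * (t <= n%:R)%R%:R.
  apply/funext => t; rewrite patchE; have [tn|tn] := boolP (t <= n%:R).
    by rewrite ifT ?mulr1 // inE /E /= in_itv.
  by rewrite ifF ?mulr0 //; apply/negP; rewrite inE /E /= in_itv /= (negPf tn).
have f0N t : 0 <= g t * (t <= n%:R)%R%:R <= N.
  by case: (t <= n%:R); rewrite ?mulr1 ?mulr0 ?g0 ?gN ?lexx //; exact: le_trans (g0 t) (gN t).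
have fsupp t : g t * (t <= n%:R)%R%:R != 0 -> s <= t <= n%:R.
  have [tn|tn] := boolP (t <= n%:R); last by rewrite mulr0 eqxx.
  by rewrite mulr1 => /gs /ltW ->.
have mf : measurable_fun setT (fun t => g t * (t <= n%:R)%R%:R).
  by apply: measurable_funM => //; exact: measurable_le_nat.
exists (fun t => g t * (t <= n%:R)%R%:R), N, n%:R; split => //.
  move=> t; apply: le_trans (gF t); rewrite lee_fin.
  by case: (t <= n%:R); rewrite ?mulr1 ?mulr0.
rewrite -fE -Rintegral_mkcond /Rintegral -lte_fin fineK //.
have ifn : mu.-integrable setT (EFin \o (fun t => g t * (t <= n%:R)%R%:R)).
  apply: (@bounded_itv_integrable _ _ N n%:R mf).
    by move=> t; have /andP[f0 ?] := f0N t; rewrite ger0_norm.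
  move=> t nt; apply/eqP; apply: contraTT nt => /fsupp/andP[st tn].
  by rewrite -leNgt ger0_norm // (le_trans s0).
have ifE : mu.-integrable (E n) (EFin \o (fun t => g t * (t <= n%:R)%R%:R)).
  by apply: integrableS ifn => //; exact: measurable_itv.
have igE : mu.-integrable (E n) (EFin \o g).
  apply: le_integrable ifE => //; first exact: measurable_itv.
    by apply/measurable_EFinP; exact: measurable_funTS.
  by move=> t; rewrite /E /= in_itv /= => tn; rewrite tn mulr1.
by apply: integrable_fin_num igE; exact: measurable_itv.
Qed.
End SimpleMinorant.

(** * The quantitative capacity bound and the conclusion *)

Section Capacity.
Variables (R : realType) (d : nat).
Local Notation mu := (@lebesgue_measure R).

Lemma perimeter_ge0 (E : set 'rV[R]_d) : (0 <= perimeter E)%E.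
Proof.
have c0 : continuous (fun _ : 'rV[R]_d => 0 : R) by exact: continuous_const.
have D0 i x : is_derive x (delta_mx 0 i) (fun _ : 'rV[R]_d => 0 : R) 0 by exact: is_derive_const.
have pd0 i : pd i (fun _ : 'rV[R]_d => 0 : R) = fun=> 0.
  by apply/funext => x; rewrite /pd; case: (D0 i x).
apply: ereal_sup_ubound; exists (fun _ _ => 0); split.
- move=> j; split; first exact: c0.
  split; first by move=> i x; case: (D0 i x).
  by move=> i; rewrite pd0.
- rewrite (_ : [set x | _] = set0) ?closure0; first exact: compact0.
  by apply/seteqP; split => // x [j]; rewrite eqxx.
- by move=> x; rewrite /enorm big1 ?sqrtr0 // => j _; rewrite !mxE expr0n.
- rewrite (_ : (fun x => _) = fun _ : 'rV[R]_d => 0%:E).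
    by rewrite (intRdE (f := fun=> 0)) ?/Jv ?J0 //; exact: bbs0.
  by apply/funext => x; rewrite big1 ?mulr0 // => j _; rewrite pd0.
Qed.

Lemma einv_ge0 (x : \bar R) : (0 <= x)%E -> (0 <= einv x)%E.
Proof.
case: x => [r||] //=; rewrite lee_fin => r0.
by case: ifP => // _; rewrite lee_fin invr_ge0.
Qed.

(** For [k = f] the bound is f^2 p <= f (f P) <= f. An approximation [k] may exceed 1/P at some
    points; there |p| <= C turns the excess into a multiple of |k - f|, which is small after
    integration. *)
Lemma energy_density_le (N C p f k : R) (P : \bar R) : (0 <= P)%E ->
  (p%:E <= P)%E -> `|p| <= C -> 0 <= f <= N -> 0 <= k <= N -> (f%:E <= einv P)%E ->
  k ^+ 2 * p <= f + 2 * N * C * `|k - f|.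
Proof.
move=> P0 pP pC /andP[f0 fN] /andP[k0 kN] fP.
have fp : f ^+ 2 * p <= f.
  (* The conventions of [einv] are harmless: [P = +oo] forces f = 0, and [P = 0] forces p <= 0. *)
  case: P P0 pP fP => [r||] //=; rewrite ?lee_fin => r0 pr; last first.
    move=> f_le0; have -> : f = 0 by apply/eqP; rewrite eq_le f_le0.
    by rewrite expr0n mul0r.
  case: ifPn => [/eqP rE _|rn0].
    by apply: le_trans f0; rewrite mulr_ge0_le0 ?sqr_ge0 // -rE.
  have rp : 0 < r by rewrite lt_neqAle eq_sym rn0.
  rewrite lee_fin => fr; rewrite expr2 -mulrA -[leRHS]mulr1; apply: ler_wpM2l => //.
  apply: le_trans (_ : f * r <= _); first exact: ler_wpM2l.
  by rewrite -ler_pdivlMr // div1r.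
have kf : (k ^+ 2 - f ^+ 2) * p <= 2 * N * C * `|k - f|.
  apply: le_trans (ler_norm _) _; rewrite subr_sqr !normrM -mulrA mulrC.
  apply: ler_wpM2r => //; apply: ler_pM => //.
  by rewrite ger0_norm ?addr_ge0 //; lra.
have -> : k ^+ 2 * p = f ^+ 2 * p + (k ^+ 2 - f ^+ 2) * p by ring.
exact: lerD.
Qed.

(** The competitor has energy at most 8 I and is at least c >= I / 2 on [A]; dividing it by [c]
    gives the capacity bound 8 I / (I / 2)^2 = 32 / I. *)
Lemma Ncap_le (K A : set 'rV[R]_d) (f : R -> R) (N s T I : R) :
  compact A -> A !=set0 -> K `<=` A -> 0 < s -> measurable_fun setT f ->
  (forall t, 0 <= f t <= N) -> (forall t, f t != 0 -> s <= t <= T) ->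
  (forall t, ((f t)%:E <= einv (perimeter (nbhd_closed A t)))%E) ->
  0 < I -> I = \int[mu]_t f t -> (Ncap K <= (32 / I)%:E)%E.
Proof.
move=> cA A0 KA s0 mf fN fsupp fP I0 IE.
have N0 : 0 <= N by have /andP[] := fN 0; exact: le_trans.
have s2 : 0 < s / 2 by rewrite divr_gt0.
(* The maximum yields [s / 2 <= T'] without exhibiting a point where [f] is nonzero. *)
pose T' : R := Num.max (T + 1) (s / 2).
have sT' : s / 2 <= T' by rewrite le_max lexx orbT.
have [C C0 HC] := radial_competitors cA A0 s2 sT'.
(* [Q] dominates 1, N, N C and N^2 C, the coefficients of [e] in all error terms, so each of [h1] to
   [h4] is at most I / 4. The total energy is then at most 4 (I + I/2 + I/4) <= 8 I, and c >= I -
   I/4 - I/4. *)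
pose Q := (N + 1) ^+ 2 * (C + 1).
have N1 : 1 <= (N + 1) ^+ 2 by rewrite exprn_ege1 // lerDr.
have Q1 : 1 <= Q by rewrite mulr_ege1 // lerDr.
have Q0 : 0 < Q by exact: lt_le_trans ltr01 Q1.
pose e := I / (4 * Q).
have e0 : 0 < e by rewrite divr_gt0 // mulr_gt0.
have eI c : 0 <= c -> c <= Q -> c * e <= I / 4.
  move=> c0 cQ; apply: le_trans (ler_wpM2r (ltW e0) cQ) _.
  by rewrite /e le_eqVlt; apply/orP; left; apply/eqP; field; rewrite gt_eqF.
have fsupp' t : f t != 0 -> 2 * (s / 2) <= t <= T.
  by move=> /fsupp; rewrite mulrC divfK.
have [k [ck kN ksupp kf]] := continuous_approx mf fN fsupp' s2 e0.
have k0 t : 0 <= k t by have /andP[] := kN t.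
have kM t : k t <= N by have /andP[] := kN t.
have ksupp' t : k t != 0 -> s / 2 <= t <= T'.
  by move=> /ksupp/andP[-> h]; rewrite le_max h.
have [u [g [B [p [[B0 uB cu cg ug] [u0 uA pP mp En]]]]]] :=
  HC k N ck k0 kM ksupp' e e0.
pose W : R := Num.max `|T| T'.
have fout t : W < `|t| -> f t = 0.
  move=> Wt; apply/eqP; apply: contraTT Wt => /fsupp/andP[st tT].
  rewrite -leNgt ger0_norm; last by rewrite (le_trans _ st) // ltW.
  by rewrite /W le_max (le_trans tT) // ler_norm.
have kout t : W < `|t| -> k t = 0.
  move=> Wt; apply/eqP; apply: contraTT Wt => /ksupp'/andP[st tT].
  rewrite -leNgt ger0_norm; last by rewrite (le_trans _ st) // ltW.
  by rewrite /W le_max tT orbT.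
have mk : measurable_fun setT k by exact: continuous_measurable_fun.
have mkf : measurable_fun setT (fun t => `|k t - f t|).
  by apply: measurableT_comp => //; exact: measurable_funB.
have fb t : `|f t| <= N by have /andP[? ?] := fN t; rewrite ger0_norm.
have kb t : `|k t| <= N by rewrite ger0_norm.
have iF := bounded_itv_integrable mf fb fout.
have iK := bounded_itv_integrable mk kb kout.
have iKF : mu.-integrable setT (EFin \o (fun t => `|k t - f t|)).
  apply: (@bounded_itv_integrable _ _ (N + N) W mkf).
    move=> t; rewrite normr_id; apply: le_trans (ler_normB _ _) _; exact: lerD.
  by move=> t Wt; rewrite fout // kout // subrr normr0.
have iKP : mu.-integrable setT (EFin \o (fun t => k t ^+ 2 * p t)).
  apply: (@bounded_itv_integrable _ _ (N ^+ 2 * C) W mp).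
    move=> t; rewrite normrM normrX; apply: ler_pM => //.
      by rewrite ler_pXn2r ?nnegrE.
    by have [] := pP t.
  by move=> t Wt; rewrite kout // expr0n mul0r.
have iKF2 : mu.-integrable setT (EFin \o (fun t => 2 * N * C * `|k t - f t|)).
  have mkf2 : measurable_fun setT (fun t => 2 * N * C * `|k t - f t|).
    by apply: measurable_funM.
  apply: (@bounded_itv_integrable _ _ (2 * N * C * (N + N)) W mkf2).
    move=> t; rewrite normrM normr_id ger0_norm ?mulr_ge0 //.
    apply: ler_wpM2l; first by rewrite !mulr_ge0.
    by apply: le_trans (ler_normB _ _) _; exact: lerD.
  by move=> t Wt; rewrite fout // kout // subrr normr0 mulr0.
have intk : I - e <= \int[mu]_t k t.
  rewrite lerBlDr; apply: le_trans (_ : \int[mu]_t k t + \int[mu]_t `|k t - f t| <= _).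
    rewrite IE -RintegralD //; apply: le_Rintegral => //.
      exact: (integrableD measurableT iK iKF).
    by move=> t _; rewrite -lerBlDl distrC; exact: ler_norm.
  by rewrite lerD2l.
have intkp : \int[mu]_t (k t ^+ 2 * p t) <= I + 2 * N * C * e.
  apply: le_trans (_ : \int[mu]_t (f t + 2 * N * C * `|k t - f t|) <= _).
    apply: le_Rintegral => //.
      exact: (integrableD measurableT iF iKF2).
    move=> t _; have [pPt pC] := pP t.
    exact: energy_density_le (perimeter_ge0 _) pPt pC (fN t) (kN t) (fP t).
  rewrite RintegralD //.
  by rewrite -IE lerD2l RintegralZl // ler_wpM2l // !mulr_ge0.
have N2 : N ^+ 2 <= (N + 1) ^+ 2 by rewrite ler_pXn2r ?nnegrE ?lerDl ?addr_ge0.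
have N3 : N <= (N + 1) ^+ 2 by nra.
have NC0 : 0 <= N * C by exact: mulr_ge0.
have h1 : 1 * e <= I / 4 by exact: eI.
have h2 : N * e <= I / 4 by apply: eI => //; rewrite /Q; nra.
have h3 : (N * C) * e <= I / 4 by apply: eI => //; rewrite /Q ler_pM // lerDl.
have h4 : (N ^+ 2 * C) * e <= I / 4.
  by apply: eI; rewrite ?mulr_ge0 ?sqr_ge0 // /Q ler_pM ?sqr_ge0 // lerDl.
have [c cE] : exists c : R, c = \int[mu]_t k t - N * e by eexists.
have cI : I / 2 <= c by rewrite cE; move: intk h1 h2; clear; lra.
have c0 : 0 < c by apply: lt_le_trans cI; rewrite divr_gt0.
have E8 : Jv (fun x => \sum_i g i x ^+ 2) <= 8 * I.
  apply: le_trans En _; rewrite (mulrAC (N ^+ 2)); lra.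
have [uD1 uE] := scaled_C1_in_D1 c^-1 B0 uB cu cg ug.
apply: le_trans (_ : (c^-1 ^+ 2 * Jv (fun x => \sum_i g i x ^+ 2))%:E <= _)%E.
  apply: ereal_inf_lbound; exists (fun x => c^-1 * u x), (fun i x => c^-1 * g i x).
  split => //; first by apply: continuous_mul => //; exact: continuous_const.
  move=> x; rewrite indicE; have [xK|xK] := boolP (x \in K).
    rewrite mulrC ler_pdivlMr // mul1r cE; apply: uA; apply: KA; exact: set_mem.
  by rewrite mulr_ge0 // invr_ge0 ltW.
rewrite lee_fin exprVn mulrC ler_pdivrMr ?exprn_gt0 //.
apply: le_trans E8 _.
apply: le_trans (_ : 32 / I * (I / 2) ^+ 2 <= _).
  by rewrite le_eqVlt; apply/orP; left; apply/eqP; field; rewrite gt_eqF.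
rewrite ler_wpM2l ?divr_ge0 ?(ltW I0) // ler_pXn2r ?nnegrE //; [lra|exact: ltW].
Qed.
End Capacity.

Theorem theorem1 (R : realType) (d : nat) (K : set 'rV[R]_d) :
  (3 <= d)%N -> compact K -> K !=set0 ->
  (\int[@lebesgue_measure R]_(t in `]s, +oo[%classic)
      einv (perimeter (nbhd_closed (fill K) t)))%E @[s --> 0^'+] --> +oo%E ->
  Ncap K = 0%E.
Proof.
move=> _ cK K0 /cvgey_gt divergent.
apply/eqP; rewrite eq_le; apply/andP; split; last first.
  apply/ereal_infP => _ [u [g [_ _ _ ->]]].
  apply: iint_ge0 => t; rewrite lee_fin.
  by apply: sumr_ge0 => i _; exact: sqr_ge0.
apply/lee_addgt0Pr => eps eps0; rewrite add0e.
(* Once the integral of the minorant exceeds [32 / eps], the bound of [Ncap_le] falls below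
   [eps]. *)
have [s [s0 large]] : exists s : R, 0 < s /\
  ((32 / eps)%:E < \int[@lebesgue_measure R]_(t in `]s, +oo[%classic)
      einv (perimeter (nbhd_closed (fill K) t)))%E.
  have [s [s0 ?]] := filter_ex (filterI (nbhs_right_gt 0) (divergent (32 / eps))).
  by exists s.
have P0 t : (0 <= einv (perimeter (nbhd_closed (fill K) t)))%E.
  exact/einv_ge0/perimeter_ge0.
have [f [N [T [mf fN fP fsupp If]]]] := bounded_minorant P0 (ltW s0) large.
have I0 : 0 < \int[@lebesgue_measure R]_t f t.
  by apply: lt_trans If; rewrite divr_gt0.
have fill0 : fill K !=set0 by case: K0 => x Kx; exists x; exact: sub_fill.
apply: le_trans (Ncap_le (compact_fill cK) fill0 (@sub_fill _ _ K) s0 mf fN fsupp fP I0 erefl) _.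
rewrite lee_fin ler_pdivrMr // mulrC -ler_pdivrMr //; exact: ltW.
Qed.
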